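(* Fix an integer $p\geq 3$ and $(\beta,h)\in(0,\infty)^2$, and let $\bm X=(X_1,\ldots,X_N)$ be a sample from the $p$-spin Curie-Weiss model $\mathbb{P}_{\beta,h,p}$ (defined in the context), with $S_N=\sum_{i=1}^N X_i$. Then: \begin{enumerate} \item If $(\beta,h)$ is $p$-regular, with $m_*$ the unique global maximizer of $H$, then $$\sup_{x\in\mathbb{R}}\left|\mathbb{P}\left(\frac{S_N-Nm_*}{\sqrt{-N/H''(m_* )}}\leq x\right)-\Phi(x)\right| = O\left(\frac{1}{\sqrt N}\right).$$ \item If $(\beta,h)$ is $p$-critical, then for every global maximizer $m$ of $H$ and every neighborhood $A$ of $m$ whose closure contains no other global maximizer of $H$, $$\sup_{x\in\mathbb{R}}\left|\mathbb{P}\left(\frac{S_N-Nm}{\sqrt{-N/H''(m)}}\leq x\,\Big|\,\frac{S_N}{N}\in A\right)-\Phi(x)\right| = O\left(\frac{1}{\sqrt N}\right).$$ \item If $(\beta,h)$ is $p$-special, with $m_*$ the unique global maximizer of $H$, then $$\sup_{x>0}\left|\mathbb{P}\left(\frac{S_N-Nm_*}{N^{3/4}}\leq x\right)-F(x)\right| = O\left(\frac{1}{N^{1/4}}\right),$$ where $F$ is the distribution function with Lebesgue density $\frac{2}{\Gamma(1/4)}\left(-\frac{H^{(4)}(m_* )}{24}\right)^{1/4}\exp\left(\frac{H^{(4)}(m_* )}{24}x^4\right)$, $x\in\mathbb{R}$. \end{enumerate}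
   Context: For $p\geq 2$, $\beta>0$, $h>0$, the $p$-spin Curie-Weiss model is the probability measure on $\{-1,1\}^N$ given by $$\mathbb{P}_{\beta,h,p}(\bm X) = \frac{\exp\left\{\beta N^{1-p}\sum_{1\leq i_1,\ldots,i_p\leq N} X_{i_1}\cdots X_{i_p} + h\sum_{i=1}^N X_i\right\}}{2^N Z_N(\beta,h,p)},$$ with $Z_N(\beta,h,p)$ the normalizing constant. Let $I(x)=\frac12\{(1+x)\log(1+x)+(1-x)\log(1-x)\}$ and $H(x)=H_{\beta,h,p}(x)=\beta x^p+hx-I(x)$ for $x\in[-1,1]$; $H^{(4)}$ is its fourth derivative. A global maximizer of $H$ is a point of $[-1,1]$ at which $H$ attains its maximum over $[-1,1]$. The point $(\beta,h)$ is $p$-regular if $H$ has a unique global maximizer $m_*\in(-1,1)$ with $H''(m_* )<0$; $p$-special if $H$ has a unique global maximizer $m_*\in(-1,1)$ with $H''(m_* )=0$; $p$-critical if $H$ has more than one global maximizer. $\Phi$ is the standard normal distribution function. *)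

(* Defs.v *)
From HB Require Import structures.
From mathcomp Require Import all_boot all_order all_algebra.
From mathcomp Require Import all_classical all_reals all_analysis.
Set Implicit Arguments. Unset Strict Implicit. Unset Printing Implicit Defensive.
Import Order.TTheory GRing.Theory Num.Theory.
Import numFieldNormedType.Exports.
Local Open Scope classical_set_scope.
Local Open Scope ring_scope.

Section CW.
Variable R : realType.

Definition spin (b : bool) : R := if b then 1 else -1.

Definition config (N : nat) := {ffun 'I_N -> bool}.

Definition SN (N : nat) (x : config N) : R := \sum_(i < N) spin (x i).

Definition cw_energy (beta h : R) (p N : nat) (x : config N) : R :=
  beta * (N%:R `^ (1 - p%:R))
       * (\sum_(i : {ffun 'I_p -> 'I_N}) \prod_(k < p) spin (x (i k)))
  + h * SN x.

Definition cw_Z (beta h : R) (p N : nat) : R :=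
  (\sum_(x : config N) expR (cw_energy beta h p x)) / (2 ^+ N).

Definition cw_pmf (beta h : R) (p N : nat) (x : config N) : R :=
  expR (cw_energy beta h p x) / (2 ^+ N * cw_Z beta h p N).

Definition cw_prob (beta h : R) (p N : nat) (E : pred (config N)) : R :=
  \sum_(x : config N | E x) cw_pmf beta h p x.

Definition cw_cond (beta h : R) (p N : nat) (E F : pred (config N)) : R :=
  cw_prob beta h p [pred x | E x && F x] / cw_prob beta h p F.

Definition Ient (x : R) : R :=
  2^-1 * ((1 + x) * ln (1 + x) + (1 - x) * ln (1 - x)).

Definition Hfun (beta h : R) (p : nat) (x : R) : R :=
  beta * x ^+ p + h * x - Ient x.

Definition is_gmax (beta h : R) (p : nat) (m : R) : Prop :=
  -1 <= m <= 1 /\ forall y : R, -1 <= y <= 1 -> Hfun beta h p y <= Hfun beta h p m.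

Definition p_regular (beta h : R) (p : nat) : Prop :=
  exists m, [/\ -1 < m < 1, is_gmax beta h p m,
     (forall y, is_gmax beta h p y -> y = m) &
     derive1n 2 (Hfun beta h p) m < 0].

Definition p_special (beta h : R) (p : nat) : Prop :=
  exists m, [/\ -1 < m < 1, is_gmax beta h p m,
     (forall y, is_gmax beta h p y -> y = m) &
     derive1n 2 (Hfun beta h p) m = 0].

Definition p_critical (beta h : R) (p : nat) : Prop :=
  exists m1 m2, [/\ m1 != m2, is_gmax beta h p m1 & is_gmax beta h p m2].

Definition Phi (x : R) : R :=
  fine (\int[lebesgue_measure]_(t in `]-oo, x])
          ((Num.sqrt (2 * pi))^-1 * expR (- (t ^+ 2) / 2))%:E).

Definition Gamma_quarter : R :=
  fine (\int[lebesgue_measure]_(t in `]0, +oo[)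
          (t `^ (- (3 / 4)) * expR (- t))%:E).

(** the distribution function F of part 3, given c4 = H^{(4)}(m_star) *)
Definition Fspecial (c4 : R) (x : R) : R :=
  fine (\int[lebesgue_measure]_(t in `]-oo, x])
          (2 / Gamma_quarter * (- c4 / 24) `^ (1 / 4)
             * expR (c4 / 24 * t ^+ 4))%:E).

End CW.
Arguments SN {R} {N} x.

(* Main.v *)
(** Grouped by the number [k] of plus spins, the configurations have total weight
    [C(N, k) * exp (N * (beta * x ^ p + h * x))] with [x = 2 k / N - 1].  The ratio of
    [C(N, k)] to [2 ^ N * exp (- N * I x)] has explicit increments in [k], so that it is
    constant up to a factor [1 + O(|x - m|)] near a maximizer [m] and is at most
    polynomial everywhere: no Stirling constant is needed, because the weights are only
    used up to normalization.  A Taylor expansion of [H] at [m] to order [2 q] ([q = 1],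
    or [q = 2] in the special case) then compares the weights with the values of
    [exp (- a * t ^ (2 q))] on a lattice of mesh [O(e)], where [e = N ^ (- 1 / (2 q))] and
    [t = (x - m) / e].  Each lattice term is within [O(e) * mesh / (1 + t ^ 2)] of the
    corresponding increment of the limit distribution function, and these errors
    are summable uniformly in [N]. *)

Require Import Defs.
From HB Require Import structures.
From mathcomp Require Import all_boot all_order all_algebra.
From mathcomp Require Import all_classical all_reals all_analysis.
From mathcomp Require Import measurable_realfun.
From mathcomp Require Import ring lra zify.
Import Order.TTheory GRing.Theory Num.Theory.
Import numFieldNormedType.Exports.
Local Open Scope classical_set_scope.
Local Open Scope ring_scope.

(** * Comparing lattice sums with distribution functions *)

(** All three parts are one statement about ratios of lattice sums. Conditioning on [A] sets the
    weights outside [A] to zero, and [A = setT] gives the unconditional parts. The limit law enters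
    only through the derivative and the limits at infinity of its distribution function [F]; as [F]
    has total mass one, the estimate for the numerator also determines the denominator. The order of
    contact at the maximizers is not part of the hypotheses: the critical case needs a negative
    second derivative at every maximizer, the special case a vanishing third and a negative fourth
    derivative. A maximum forces the third derivative to vanish with the second. Eliminating [beta]
    from these two equations leaves a single possible point in [(0, 1)], where the fourth derivative
    is negative; when there are two maximizers, Rolle's theorem shows that neither sits there. *)

Lemma expR_ge_pow (R : realType) (n : nat) (x : R) :
  0 <= x -> x ^+ n <= n`!%:R * expR x.
Proof.
move=> x0; case: n => [|n].
  by rewrite expr0 fact0 mul1r; have := expR_ge1Dx x; lra.
have := expR_ge1Dxn n x0; have f0 : 0 < n.+1`!%:R :> R by rewrite ltr0n fact_gt0.
rewrite -ler_pdivrMl// mulrC; lra.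
Qed.

Lemma expR_dist1 (R : realType) (x : R) : `|expR x - 1| <= `|x| * expR `|x|.
Proof.
have [x0|x0] := leP 0 x.
  have h := expR_ge1Dx (- x); have e0 := expR_gt0 x.
  have e1 := expR_ge1Dx x.
  rewrite !ger0_norm//; last lra.
  have := expRxMexpNx_1 x; nra.
have h := expR_ge1Dx x; have e1 := expR_ge1Dx `|x|.
have := @expR_lt1 R x; rewrite x0 => e2.
rewrite distrC ger0_norm; last lra.
move: e1; rewrite ltr0_norm//; nra.
Qed.

Lemma MVT_le (R : realType) (f df : R -> R) (a b : R) : a <= b ->
  (forall x : R, a <= x <= b -> is_derive x 1 f (df x)) ->
  exists2 c, a <= c <= b & f b - f a = df c * (b - a).
Proof.
move=> ab fd; have [|//|c cab ->] := @MVT_segment R f df a b ab.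
- by move=> x; rewrite in_itv/= => /andP[ax xb]; apply: fd; rewrite !ltW.
- apply: derivable_within_continuous => x; rewrite in_itv/= => /fd.
  by move=> h; exact: (@ex_derive _ _ _ _ _ _ _ h).
- by exists c => //; move: cab; rewrite in_itv.
Qed.

(** One integration of a bound on the derivative. The factor [1 / n.+1] that integration would yield
    is given up, so that one constant [K] survives the iteration in [taylor_critical]. *)
Lemma MVT_norm (R : realType) (f df : R -> R) (K d u : R) (n : nat) :
  f 0 = 0 -> 0 <= K -> `|u| <= d ->
  (forall x : R, `|x| <= d -> is_derive x 1 f (df x) /\ `|df x| <= K * `|x| ^+ n) ->
  `|f u| <= K * `|u| ^+ n.+1.
Proof.
move=> f0 K0 ud fd.
suff [c cu ->] : exists2 c, `|c| <= `|u| & f u = df c * u.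
  have cd : `|c| <= d by exact: le_trans cu ud.
  have [_ h] := fd _ cd.
  rewrite normrM exprSr mulrA ler_wpM2r//.
  by rewrite (le_trans h)// ler_wpM2l// lerXn2r// nnegrE.
have [u0|/ltW u0] := leP 0 u.
- have [x /andP[x0 xu]|c /andP[c0 cu]] := @MVT_le R f df 0 u u0.
    by have [] := fd x; rewrite // ger0_norm// (le_trans xu)// -(ger0_norm u0).
  by rewrite f0 !subr0 => e; exists c => //; rewrite !ger0_norm.
- have [x /andP[x0 xu]|c /andP[c0 cu]] := @MVT_le R f df u 0 u0.
    by have [] := fd x; rewrite // ler0_norm// (le_trans _ ud)// ler0_norm// lerN2.
  rewrite f0 !sub0r mulrN => /oppr_inj e.
  by exists c => //; rewrite !ler0_norm// lerN2.
Qed.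

(* The single estimate that absorbs every polynomial error factor of the local
   expansion into the summable weight [1 / (1 + t ^+ 2)]. *)
Lemma exp_pow_decay (R : realType) (a : R) (q : nat) : 0 < a -> (0 < q)%N ->
  exists2 C : R, 0 < C & forall t : R,
    (`|t| ^+ (2 * q).+1 + `|t| + 1) * (1 + t ^+ 2) * expR (- (a * t ^+ (2 * q)))
      <= C.
Proof.
(* With [s = t ^+ (2 * q)] the polynomial factor is at most [6 + 6 * s ^+ 3]: the first 6 covers
   [|t| <= 1], and otherwise [2 * q + 3 <= 6 * q]. Then [s ^+ 3 <= 3! / a ^+ 3 * expR (a * s)] gives
   [36 / a ^+ 3]. *)
move=> a0 q0; exists (6 + 36 / a ^+ 3).
  by rewrite addr_gt0// divr_gt0// exprn_gt0.
move=> t; set s := t ^+ (2 * q).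
have s0 : 0 <= s by rewrite /s exprM exprn_ge0// sqr_ge0.
have as0 : 0 <= a * s by rewrite mulr_ge0// ltW.
have sE : s = `|t| ^+ (2 * q) by rewrite /s !exprM real_normK ?num_real.
have e3 := expR_ge_pow _ 3 _ as0.
have e1 := expR_ge1Dx (a * s).
have ep := expR_gt0 (a * s).
have a30 : 0 < a ^+ 3 by rewrite exprn_gt0.
rewrite expRN ler_pdivrMr//.
have t2 : t ^+ 2 = `|t| ^+ 2 by rewrite real_normK ?num_real.
have : (`|t| ^+ (2 * q).+1 + `|t| + 1) * (1 + t ^+ 2) <= 6 + 6 * s ^+ 3.
  rewrite t2 sE; have := normr_ge0 t; set y := `|t| => y0.
  have [y1|y1] := leP y 1.
    have h1 : y ^+ (2 * q).+1 <= 1 by exact: exprn_ile1.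
    have h1' : 0 <= y ^+ (2 * q).+1 by exact: exprn_ge0.
    have h2 : y ^+ 2 <= 1 by exact: exprn_ile1.
    have h2' : 0 <= y ^+ 2 by exact: exprn_ge0.
    have h3 : 0 <= 6 * (y ^+ (2 * q)) ^+ 3 by rewrite mulr_ge0// !exprn_ge0.
    rewrite -[leLHS]addr0 lerD// [leRHS](_ : _ = 3 * 2); last by ring.
    by apply: ler_pM; lra.
  have y1' := ltW y1.
  have h1 : y <= y ^+ (2 * q).+1 by rewrite -[leLHS]expr1 ler_weXn2l.
  have h2 : 1 <= y ^+ (2 * q).+1 by rewrite exprn_ege1.
  have h3 : 1 <= y ^+ 2 by rewrite exprn_ege1.
  have h4 : y ^+ (2 * q).+1 * y ^+ 2 <= (y ^+ (2 * q)) ^+ 3.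
    rewrite -exprD -exprM ler_weXn2l//; clear -q0; lia.
  apply: (@le_trans _ _ (6 * (y ^+ (2 * q).+1 * y ^+ 2))); last by lra.
  have -> : 6 * (y ^+ (2 * q).+1 * y ^+ 2) = (3 * y ^+ (2 * q).+1) * (2 * y ^+ 2).
    by ring.
  by apply: ler_pM; lra.
move=> /le_trans; apply.
have -> : 36 / a ^+ 3 = 6 * (6 / a ^+ 3) by field; rewrite gt_eqF.
have : s ^+ 3 <= 6 / a ^+ 3 * expR (a * s).
  rewrite mulrAC ler_pdivlMr// -exprMn mulrC; exact: e3.
lra.
Qed.

(** Each term is at most three times the increment of [atan] over the mesh interval ending at its
    node, and these increments telescope to less than [pi]. Independence of [n] and [t0] is what
    makes the total error uniform in [N]. *)
Lemma sum_telescope_le (R : realType) (t0 d : R) (n : nat) : 0 < d <= 1 ->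
  \sum_(k < n) d / (1 + (t0 + k%:R * d) ^+ 2) <= 3 * pi.
Proof.
move=> /andP[d0 d1].
have step (k : nat) : d / (1 + (t0 + k%:R * d) ^+ 2) <=
    3 * (atan (t0 + k%:R * d) - atan (t0 + k%:R * d - d)).
  set t := t0 + _.
  have h1 : t - d <= t by lra.
  have [c /andP[c1 c2] ->] := @MVT_le R atan (fun x => (1 + x ^+ 2)^-1) _ _ h1.
  - have -> : t - (t - d) = d by lra.
    have t0' := sqr_ge0 t; have c0' := sqr_ge0 c.
    rewrite mulrC mulrA ler_wpM2r//; first exact: ltW.
    rewrite ler_pdivlMr; last lra.
    rewrite mulrC ler_pdivrMr; last lra.
    have h2 := sqr_ge0 (2 * t - c).
    have h3 : 0 <= (1 - (t - c)) * (1 + (t - c)) by apply: mulr_ge0; lra.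
    lra.
apply: (@le_trans _ _ (\sum_(k < n) 3 * (atan (t0 + k%:R * d) - atan (t0 + k%:R * d - d)))).
  by apply: ler_sum => k _; exact: step.
rewrite -mulr_sumr ler_wpM2l//.
have -> : \sum_(k < n) (atan (t0 + k%:R * d) - atan (t0 + k%:R * d - d)) =
   atan (t0 + n%:R * d - d) - atan (t0 - d).
  elim: n => [|n IH]; first by rewrite big_ord0 mul0r addr0 subrr.
  rewrite big_ord_recr/= IH -natr1.
  have -> : t0 + (n%:R + 1) * d - d = t0 + n%:R * d by ring.
  by ring.
have := @atan_ltpi2 R (t0 + n%:R * d - d); have := @atan_gtNpi2 R (t0 - d).
lra.
Qed.

Lemma sqr_near (R : realType) (s t : R) : `|s - t| <= 1 -> 1 + t ^+ 2 <= 3 * (1 + s ^+ 2).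
Proof.
rewrite ler_norml => /andP[h1 h2].
have h3 := sqr_ge0 (2 * s - t); have h5 := sqr_ge0 s.
have h4 : 0 <= (1 - (s - t)) * (1 + (s - t)) by apply: mulr_ge0; lra.
lra.
Qed.

Lemma is_derive_pow (R : realType) (n : nat) (x : R) :
  is_derive x 1 (fun t : R => t ^+ n) (n%:R * x ^+ n.-1).
Proof.
have := @is_deriveX R R id n x 1 1 (is_derive_id _ _).
rewrite /GRing.scale/= mulr1 mulr_natl.
by congr is_derive; apply/funext => t; rewrite fctE.
Qed.

Lemma is_derive_exp_pow (R : realType) (a : R) (n : nat) (t : R) :
  is_derive t 1 (fun t : R => expR (- (a * t ^+ n)))
    (- (a * (n%:R * t ^+ n.-1)) * expR (- (a * t ^+ n))).
Proof.
have h0 := is_derive_pow _ n t.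
have h : is_derive t 1 (fun t : R => - (a * t ^+ n)) (- (a * (n%:R * t ^+ n.-1))).
  exact: is_derive_eq.
have := @is_derive1_comp R expR (fun t : R => - (a * t ^+ n)) t _ _ (is_derive_expR _) h.
by rewrite mulrC.
Qed.

(** Two uses of the mean value theorem: the increment of [F] is [d] times the density at some [s] in
    the interval, and the density changes between [s] and [t] by its derivative times [t - s]. That
    derivative decays like [1 / (1 + t ^+ 2)] by [exp_pow_decay]. *)
Lemma cdf_step (R : realType) (F : R -> R) (a c : R) (q : nat) :
  0 < a -> 0 < c -> (0 < q)%N ->
  (forall t : R, is_derive t 1 F (c * expR (- (a * t ^+ (2 * q))))) ->
  exists2 B : R, 0 < B & forall t d : R, 0 < d <= 1 ->
    `|F t - F (t - d) - d * (c * expR (- (a * t ^+ (2 * q))))|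
      <= B * d ^+ 2 / (1 + t ^+ 2).
Proof.
move=> a0 c0 q0 dF; have [C C0 decay] := @exp_pow_decay R a q a0 q0.
pose g t : R := expR (- (a * t ^+ (2 * q))).
have q20 : 0 < (2 * q)%:R :> R by rewrite ltr0n muln_gt0.
exists (c * (a * (2 * q)%:R * (3 * C))); first by rewrite !mulr_gt0.
move=> t d /andP[d0 d1].
have h1 : t - d <= t by lra.
have [s /andP[s1 s2] ->] := @MVT_le R F _ _ _ h1 (fun x _ => dF x).
have -> : t - (t - d) = d by lra.
have [r /andP[r1 r2]] := @MVT_le R _ _ _ _ s2 (fun x _ => @is_derive_exp_pow R a (2 * q) x).
rewrite -/(g s) -/(g t) -/(g r) => gE.
have -> : c * g s * d - d * (c * g t) = - (c * d * (g t - g s)) by ring.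
rewrite gE normrN !normrM normrN !normrM normrX.
have [rc rt] : `|r - t| <= 1 /\ `|t - s| <= d.
  by split; rewrite ler_norml; apply/andP; split; lra.
have h2 := sqr_near _ _ _ rc.
rewrite (gtr0_norm c0) (gtr0_norm d0) (gtr0_norm a0) (gtr0_norm q20).
rewrite [`|g r|]gtr0_norm ?expR_gt0//.
have t0 : 0 < 1 + t ^+ 2 by have := sqr_ge0 t; lra.
have r0 : 0 < 1 + r ^+ 2 by have := sqr_ge0 r; lra.
have key : `|r| ^+ (2 * q).-1 * g r * (1 + t ^+ 2) <= 3 * C.
  apply: (@le_trans _ _ (`|r| ^+ (2 * q).-1 * g r * (3 * (1 + r ^+ 2)))).
    by rewrite ler_wpM2l// mulr_ge0 ?exprn_ge0 ?expR_ge0.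
  have := decay r; rewrite -/(g r) => dr.
  have h3 : `|r| ^+ (2 * q).-1 <= `|r| ^+ (2 * q).+1 + `|r| + 1.
    have y0 := normr_ge0 r.
    have p1 := exprn_ge0 (2 * q).-1 y0; have p2 := exprn_ge0 (2 * q).+1 y0.
    have [y1|y1] := leP `|r| 1.
      by have := exprn_ile1 (2 * q).-1 y0 y1; lra.
    have : `|r| ^+ (2 * q).-1 <= `|r| ^+ (2 * q).+1.
      by rewrite ler_weXn2l ?(ltW y1)//; clear; lia.
    lra.
  have h4 : `|r| ^+ (2 * q).-1 * ((1 + r ^+ 2) * g r) <=
      (`|r| ^+ (2 * q).+1 + `|r| + 1) * ((1 + r ^+ 2) * g r).
    by rewrite ler_wpM2r// mulr_ge0 ?expR_ge0 ?(ltW r0).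
  lra.
rewrite ler_pdivlMr//.
have -> : c * d * (a * ((2 * q)%:R * `|r| ^+ (2 * q).-1) * g r * `|t - s|) * (1 + t ^+ 2)
  = (c * (a * (2 * q)%:R) * d) * (`|r| ^+ (2 * q).-1 * g r * (1 + t ^+ 2)) * `|t - s|.
  by ring.
have -> : c * (a * (2 * q)%:R * (3 * C)) * d ^+ 2 = (c * (a * (2 * q)%:R) * d) * (3 * C) * d.
  by ring.
apply: ler_pM => //.
  by rewrite !mulr_ge0 ?exprn_ge0 ?expR_ge0 ?(ltW c0) ?(ltW a0) ?(ltW d0) ?(ltW t0).
by rewrite ler_wpM2l// !mulr_ge0 ?(ltW c0) ?(ltW a0) ?(ltW d0).
Qed.

Lemma pinfty_lim_le (R : realType) (F : R -> R) (l K x : R) :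
  F y @[y --> +oo] --> l -> (forall y, x <= y -> F y <= K) -> l <= K.
Proof.
move=> Fl FK; rewrite leNgt; apply/negP => Kl.
have h1 : \forall y \near +oo, K < F y by exact: cvgr_gt Fl _ Kl.
have h2 : \forall y \near +oo, x <= y.
  by apply: nbhs_pinfty_ge; exact: num_real.
have [y [/= y1 y2]] := filter_ex (filterI h1 h2).
by have := FK _ y2; rewrite leNgt y1.
Qed.

Lemma mono_pinfty_lim_le (R : realType) (F : R -> R) (l x : R) :
  {homo F : x y / x <= y} -> F y @[y --> +oo] --> l -> F x <= l.
Proof.
move=> mF Fl; rewrite -lerN2; apply: (pinfty_lim_le _ (- F) _ _ x (cvgN Fl)).
by move=> y xy; rewrite lerN2 mF.
Qed.

(** The density is at most [c * C / x ^+ 2], so [F x + c * C / x] is nonincreasing for [x > 0];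
    comparing its value at [t] with its limit at infinity bounds the tail. *)
Lemma cdf_upper_tail (R : realType) (F : R -> R) (a c : R) (q : nat) :
  0 < a -> 0 < c -> (0 < q)%N ->
  (forall t : R, is_derive t 1 F (c * expR (- (a * t ^+ (2 * q))))) ->
  F y @[y --> +oo] --> (1 : R) ->
  exists2 B : R, 0 < B & forall t : R, 0 < t -> 1 - F t <= B / t.
Proof.
move=> a0 c0 q0 dF F1; have [C C0 decay] := @exp_pow_decay R a q a0 q0.
exists (c * C); first exact: mulr_gt0.
move=> t t0; rewrite lerBlDr; apply: (pinfty_lim_le _ _ _ _ t F1) => y ty.
have dG (x : R) : t <= x <= y -> is_derive x 1 (fun x => F x + c * C * x^-1)
    (c * expR (- (a * x ^+ (2 * q))) - c * C * x ^- 2).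
  move=> /andP[tx _]; have x0 : x != 0 by rewrite gt_eqF// (lt_le_trans t0).
  have h := dF x.
  have h2 : is_derive x 1 (fun x : R => x^-1) (- x ^- 2 *: 1).
    by apply: is_deriveV.
  apply: is_derive_eq.
  rewrite /GRing.scale/=.
  ring.
have [s /andP[s1 s2] E] := @MVT_le R _ _ _ _ ty dG.
have s0 : 0 < s by exact: lt_le_trans s1.
have s20 : 0 < s ^+ 2 by exact: exprn_gt0.
have h : c * expR (- (a * s ^+ (2 * q))) - c * C * s ^- 2 <= 0.
  rewrite -mulrA -mulrBr pmulr_rle0// subr_le0 ler_pdivlMr//.
  apply: le_trans (decay s); rewrite mulrC ler_wpM2r ?expR_ge0//.
  have p1 := exprn_ge0 (2 * q).+1 (ltW s0).
  rewrite (gtr0_norm s0) -[leLHS]mul1r; apply: ler_pM => //; lra.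
have h3 : (c * expR (- (a * s ^+ (2 * q))) - c * C * s ^- 2) * (y - t) <= 0.
  by rewrite mulr_le0_ge0// subr_ge0.
have : 0 <= c * C * y^-1 by rewrite !mulr_ge0 ?(ltW c0) ?(ltW C0)// invr_ge0; lra.
lra.
Qed.

Lemma cdf_bounds (R : realType) (F : R -> R) (a c : R) (q : nat) :
  0 < a -> 0 < c -> (0 < q)%N ->
  (forall t : R, is_derive t 1 F (c * expR (- (a * t ^+ (2 * q))))) ->
  F y @[y --> +oo] --> (1 : R) -> F y @[y --> -oo] --> (0 : R) ->
  [/\ {homo F : x y / x <= y}, (forall x, 0 <= F x <= 1),
      (forall x y, x <= y -> F y - F x <= c * (y - x)) &
      exists2 B : R, 0 < B & forall t : R, 0 < t ->
        1 - F t <= B / t /\ F (- t) <= B / t].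
Proof.
move=> a0 c0 q0 dF F1 F0.
have FM x y : x <= y -> 0 <= F y - F x <= c * (y - x).
  move=> xy; have [s _ ->] := @MVT_le R _ _ _ _ xy (fun x _ => dF x).
  rewrite -mulrA !mulr_ge0 ?(ltW c0) ?expR_ge0 ?subr_ge0//= ler_wpM2l ?(ltW c0)//.
  rewrite -[leRHS]mul1r ler_wpM2r ?subr_ge0// expR_le1 oppr_le0.
  by rewrite mulr_ge0 ?(ltW a0)// exprM exprn_ge0// sqr_ge0.
have mF : {homo F : x y / x <= y}.
  by move=> x y /FM/andP[]; rewrite subr_ge0.
(* The reflected function has the same density, as [2 * q] is even; its upper tail is the lower tail
   of [F]. *)
pose G (t : R) := 1 - F (- t).
have G1 : G y @[y --> +oo] --> (1 : R).
  rewrite -[X in _ --> X]subr0; apply: cvgB; first exact: cvg_cst.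
  exact/cvgNy_compNP.
have dG (t : R) : is_derive t 1 G (c * expR (- (a * t ^+ (2 * q)))).
  have h1 : is_derive t 1 (fun x : R => - x) (-1) by apply: is_derive_eq.
  have := @is_derive1_comp R F (fun x => - x) t _ _ (dF (- t)) h1.
  rewrite exprM sqrrN -exprM => h2.
  have {}h2 : is_derive t 1 (fun x => F (- x)) (c * expR (- (a * t ^+ (2 * q))) * -1) := h2.
  apply: is_derive_eq.
  by ring.
have [B1 B10 h1] := cdf_upper_tail _ _ _ _ _ a0 c0 q0 dF F1.
have [B2 B20 h2] := cdf_upper_tail _ _ _ _ _ a0 c0 q0 dG G1.
split => //.
- move=> x; apply/andP; split.
    have mG : {homo G : x y / x <= y}.
      by move=> u v uv; rewrite lerD2l lerN2 mF// lerN2.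
    have := mono_pinfty_lim_le _ _ _ (- x) mG G1.
    by rewrite /G opprK gerBl.
  exact: mono_pinfty_lim_le mF F1.
- by move=> x y /FM/andP[].
- exists (B1 + B2); first exact: addr_gt0.
  move=> t t0; have ti : 0 <= t^-1 by rewrite invr_ge0 ltW.
  have := h1 _ t0; have := h2 _ t0; rewrite /G mulrDl.
  have := mulr_ge0 (ltW B10) ti; have := mulr_ge0 (ltW B20) ti.
  by split; lra.
Qed.

(** Here [u] stands for [x - m] and [v] for a weight divided by a reference weight. In the window
    [|u| <= del], the condition [K * del <= a / 2] lets the error [E] consume, up to a constant, at
    most half of the exponent. Outside the window, [v] and the exponential are each small by
    themselves. *)
Lemma weight_approx (R : realType) (a del K eta : R) (q : nat) :
  0 < a -> (0 < q)%N -> 0 < del -> 0 <= K -> K * del <= a / 2 -> 0 < eta ->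
  exists2 C : R, 0 < C & forall (N : nat) (e u v : R),
    (0 < N)%N -> 0 < e <= 1 / 2 -> e ^+ (2 * q) = N%:R^-1 -> `|u| <= 2 ->
    (`|u| <= del -> exists2 E : R,
       v = expR (- (a * (N%:R * u ^+ (2 * q))) + E) &
       `|E| <= K * (N%:R * `|u| ^+ (2 * q).+1 + `|u| + N%:R^-1)) ->
    (del < `|u| -> 0 <= v <= K * N%:R ^+ 4 * expR (- (eta * N%:R))) ->
    `|v - expR (- (a * (u / e) ^+ (2 * q)))| <= C * e / (1 + (u / e) ^+ 2).
Proof.
move=> a0 q0 del0 K0 Kdel eta0.
have a20 : 0 < a / 2 by lra.
have [C C0 decay] := @exp_pow_decay R (a / 2) q a20 q0.
(* The exponent 7 is 4 from the bound on [v], 2 from [1 + t ^+ 2 <= 5 * N ^+ 2], and 1 for the gain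
   of a factor [1 / N <= e]. *)
have [M M0 ME] : exists2 M : R, 0 < M & M = 7`!%:R / eta ^+ 7.
  by eexists; last reflexivity; rewrite divr_gt0 ?exprn_gt0// ltr0n fact_gt0.
exists (K * C * expR (K * (del + 1)) + C / del + 5 * K * M).
  have h1 : 0 < C / del by exact: divr_gt0.
  have h2 : 0 <= 5 * K * M by rewrite !mulr_ge0 ?(ltW M0).
  have h3 : 0 <= K * C * expR (K * (del + 1)) by rewrite !mulr_ge0 ?expR_ge0 ?(ltW C0).
  lra.
move=> N e u v N0 /andP[e0 e1] eN u2 near_m far_m.
have n0 : 0 < N%:R :> R by rewrite ltr0n.
have n1 : 1 <= N%:R :> R by rewrite ler1n.
set t := u / e.
have uE : u = t * e by rewrite /t divfK// gt_eqF.
have uE' : `|u| = `|t| * e by rewrite uE normrM (gtr0_norm e0).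
have sE : N%:R * u ^+ (2 * q) = t ^+ (2 * q).
  by rewrite uE exprMn eN mulrCA divff ?mulr1// gt_eqF.
have t20 : 0 < 1 + t ^+ 2 by have := sqr_ge0 t; lra.
have s0 : 0 <= t ^+ (2 * q) by rewrite exprM exprn_ge0// sqr_ge0.
have sN : t ^+ (2 * q) = `|t| ^+ (2 * q) by rewrite !exprM real_normK ?num_real.
have eN1 : N%:R^-1 <= e.
  by rewrite -eN -[leRHS]expr1 ler_wiXn2l ?(ltW e0)//; [lra|clear -q0; lia].
have p0 := exprn_ge0 (2 * q).+1 (normr_ge0 t); have pt := normr_ge0 t.
have dt := decay t; set g2 := expR (- (a / 2 * t ^+ (2 * q))) in dt.
have g20 : 0 < g2 by exact: expR_gt0.
(* One factor [g2] compensates [expR |E|], the other one the polynomial in [t]. *)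
have gE : expR (- (a * t ^+ (2 * q))) = g2 * g2.
  by rewrite -expRD; congr expR; field.
have g21 : g2 <= 1 by rewrite expR_le1 oppr_le0 mulr_ge0// ltW.
rewrite ler_pdivlMr//.
have H1 : 0 <= K * C * expR (K * (del + 1)) * e.
  by rewrite !mulr_ge0 ?expR_ge0 ?(ltW C0) ?(ltW e0).
have H2 : 0 <= C / del * e by rewrite mulr_ge0 ?(ltW e0)// divr_ge0 ?(ltW C0) ?(ltW del0).
have H3 : 0 <= 5 * K * M * e by rewrite !mulr_ge0 ?(ltW M0) ?(ltW e0).
have [ud|ud] := leP `|u| del.
  have [E -> EK] := near_m ud.
  apply: (@le_trans _ _ (K * C * expR (K * (del + 1)) * e)); last by clear -H2 H3; lra.
  rewrite sE expRD -[X in _ - X]mulr1 -mulrBr normrM gtr0_norm ?expR_gt0//.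
  (* Two bounds on [E] are needed: [EK1] has the factor [e] that the conclusion asks for, while
     [EK2] controls [expR |E|] by half of the exponent. *)
  have EK1 : `|E| <= K * e * (`|t| ^+ (2 * q).+1 + `|t| + 1).
    apply: (le_trans EK); rewrite -mulrA ler_wpM2l//.
    have -> : N%:R * `|u| ^+ (2 * q).+1 = e * `|t| ^+ (2 * q).+1.
      by rewrite uE' exprSr exprMn eN exprSr; field; rewrite gt_eqF.
    rewrite uE'; clear -eN1; lra.
  have EK2 : `|E| <= a / 2 * t ^+ (2 * q) + K * (del + 1).
    apply: (le_trans EK).
    have -> : N%:R * `|u| ^+ (2 * q).+1 = `|u| * t ^+ (2 * q).
      by rewrite exprSr -sE !exprM real_normK ?num_real//; ring.
    have h1 : K * `|u| <= K * del by rewrite ler_wpM2l.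
    have h2 : K * `|u| * t ^+ (2 * q) <= a / 2 * t ^+ (2 * q).
      by rewrite ler_wpM2r//; clear -h1 Kdel; lra.
    have h3 : K * N%:R^-1 <= K * 1 by rewrite ler_wpM2l// invf_le1.
    clear -h1 h2 h3; lra.
  have h4 : expR `|E| <= g2^-1 * expR (K * (del + 1)).
    by rewrite /g2 -expRN opprK -expRD ler_expR.
  have h5 := expR_dist1 _ E.
  have h6 : `|expR E - 1| <= K * e * (`|t| ^+ (2 * q).+1 + `|t| + 1) *
      (g2^-1 * expR (K * (del + 1))).
    apply: (le_trans h5); apply: ler_pM => //; exact: expR_ge0.
  rewrite gE.
  apply: (@le_trans _ _ (g2 * g2 * (K * e * (`|t| ^+ (2 * q).+1 + `|t| + 1) *
      (g2^-1 * expR (K * (del + 1)))) * (1 + t ^+ 2))).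
    by rewrite ler_wpM2r ?(ltW t20)// ler_wpM2l// mulr_ge0 ?(ltW g20).
  have -> : g2 * g2 * (K * e * (`|t| ^+ (2 * q).+1 + `|t| + 1) *
      (g2^-1 * expR (K * (del + 1)))) * (1 + t ^+ 2) =
     (K * e * expR (K * (del + 1))) *
     ((`|t| ^+ (2 * q).+1 + `|t| + 1) * (1 + t ^+ 2) * g2).
    by field; rewrite gt_eqF.
  have -> : K * C * expR (K * (del + 1)) * e = K * e * expR (K * (del + 1)) * C by ring.
  by rewrite ler_wpM2l// !mulr_ge0 ?expR_ge0 ?(ltW e0).
have /andP[v0 vK] := far_m ud.
have h1 : expR (- (a * t ^+ (2 * q))) * (1 + t ^+ 2) <= C / del * e.
  have tdel : del / e <= `|t| by rewrite ler_pdivrMr// -uE' ltW.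
  have h : `|t| * ((1 + t ^+ 2) * g2) <= C.
    apply: le_trans dt; rewrite -mulrA ler_wpM2r//; last by clear -p0; lra.
    by rewrite mulr_ge0 ?(ltW t20) ?(ltW g20).
  have h' : del / e * ((1 + t ^+ 2) * g2) <= C.
    by apply: le_trans h; rewrite ler_wpM2r// mulr_ge0 ?(ltW t20) ?(ltW g20).
  have h'' : (1 + t ^+ 2) * g2 <= C / del * e.
    rewrite mulrAC ler_pdivlMr//.
    have -> : (1 + t ^+ 2) * g2 * del = (del / e * ((1 + t ^+ 2) * g2)) * e.
      by field; rewrite gt_eqF.
    by rewrite ler_wpM2r// ltW.
  apply: le_trans h''; rewrite gE mulrC ler_wpM2l ?(ltW t20)//.
  by rewrite -[leRHS]mulr1 ler_wpM2l// ltW.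
have h2 : v * (1 + t ^+ 2) <= 5 * K * M * e.
  have t2N : 1 + t ^+ 2 <= 5 * N%:R ^+ 2.
    have ei : e^-1 <= N%:R by rewrite -[leRHS]invrK lef_pV2 ?posrE ?invr_gt0.
    have ei0 : 0 <= e^-1 by rewrite invr_ge0 ltW.
    have tN : `|t| <= 2 * N%:R.
      rewrite /t normrM normfV (gtr0_norm e0); apply: ler_pM => //.
    have : `|t| ^+ 2 <= (2 * N%:R) ^+ 2 by rewrite lerXn2r// nnegrE; clear -n1; lra.
    rewrite real_normK ?num_real// => h.
    have h0 : 1 <= N%:R ^+ 2 :> R by rewrite exprn_ege1.
    clear -h h0; lra.
  have hN : N%:R ^+ 6 * expR (- (eta * N%:R)) <= M * N%:R^-1.
    have en0 : 0 <= eta * N%:R by rewrite mulr_ge0 ?(ltW n0) ?(ltW eta0).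
    have := expR_ge_pow _ 7 _ en0; rewrite exprMn => h.
    rewrite expRN -lter_pdivlMr ?invr_gt0 ?expR_gt0// invrK ME.
    have -> : 7`!%:R / eta ^+ 7 / N%:R * expR (eta * N%:R) =
        7`!%:R * expR (eta * N%:R) / (eta ^+ 7 * N%:R).
      by field; rewrite !gt_eqF.
    rewrite ler_pdivlMr ?mulr_gt0 ?exprn_gt0//.
    by rewrite mulrCA -exprSr.
  apply: (@le_trans _ _ (K * N%:R ^+ 4 * expR (- (eta * N%:R)) * (5 * N%:R ^+ 2))).
    by apply: ler_pM => //; exact: ltW.
  have -> : K * N%:R ^+ 4 * expR (- (eta * N%:R)) * (5 * N%:R ^+ 2) =
     5 * K * (N%:R ^+ 6 * expR (- (eta * N%:R))) by ring.
  rewrite -[leRHS]mulrA ler_wpM2l//; first by rewrite mulr_ge0.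
  by apply: (le_trans hN); rewrite ler_wpM2l// ltW.
have h3 : `|v - expR (- (a * t ^+ (2 * q)))| <= v + expR (- (a * t ^+ (2 * q))).
  have := expR_ge0 (- (a * t ^+ (2 * q))).
  by rewrite ler_norml => h; clear -h v0; apply/andP; split; lra.
have h4 := ler_wpM2r (ltW t20) h3.
clear -h1 h2 h4 H1; lra.
Qed.

(** The error carries both [e] and the mesh [d], so that its sum is [O(e)] by [sum_telescope_le].
    The quadratic error of [cdf_step] fits because [d <= 2 * e]. *)
Lemma weight_term (R : realType) (F : R -> R) (a c del K eta : R) (q : nat) :
  0 < a -> 0 < c -> (0 < q)%N ->
  (forall t : R, is_derive t 1 F (c * expR (- (a * t ^+ (2 * q))))) ->
  0 < del -> 0 <= K -> K * del <= a / 2 -> 0 < eta ->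
  exists2 C : R, 0 < C & forall (N : nat) (e u v d : R),
    (0 < N)%N -> 0 < e <= 1 / 2 -> e ^+ (2 * q) = N%:R^-1 -> `|u| <= 2 ->
    (`|u| <= del -> exists2 E : R,
       v = expR (- (a * (N%:R * u ^+ (2 * q))) + E) &
       `|E| <= K * (N%:R * `|u| ^+ (2 * q).+1 + `|u| + N%:R^-1)) ->
    (del < `|u| -> 0 <= v <= K * N%:R ^+ 4 * expR (- (eta * N%:R))) ->
    0 < d <= 1 -> d <= 2 * e ->
    `|v * d - (F (u / e) - F (u / e - d)) / c| <= C * e * (d / (1 + (u / e) ^+ 2)).
Proof.
move=> a0 c0 q0 dF del0 K0 Kdel eta0.
have [B B0 step] := cdf_step _ _ _ _ _ a0 c0 q0 dF.
have [C C0 appr] := weight_approx _ _ _ _ _ _ a0 q0 del0 K0 Kdel eta0.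
exists (C + 2 * (B / c)).
  have : 0 < B / c by exact: divr_gt0.
  lra.
move=> N e u v d N0 e01 eN u2 near_m far_m /andP[d0 d1] de.
have /andP[e0 e1] := e01.
have := appr N e u v N0 e01 eN u2 near_m far_m.
have {step} := step (u / e) d; rewrite d0 d1 => /(_ isT).
set t := u / e; set g := expR _; set D := F t - F (t - d).
have t20 : 0 < 1 + t ^+ 2 by have := sqr_ge0 t; lra.
move=> h1 h2.
have -> : v * d - D / c = d * (v - g) - (D - d * (c * g)) / c.
  by field; rewrite gt_eqF.
have h3 : `|d * (v - g)| <= d * (C * e / (1 + t ^+ 2)).
  by rewrite normrM (gtr0_norm d0) ler_wpM2l// ltW.
have h4 : `|(D - d * (c * g)) / c| <= 2 * (B / c) * e * (d / (1 + t ^+ 2)).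
  rewrite normrM normfV (gtr0_norm c0) ler_pdivrMr//; apply: (le_trans h1).
  have -> : 2 * (B / c) * e * (d / (1 + t ^+ 2)) * c = B * d / (1 + t ^+ 2) * (2 * e).
    by field; rewrite !gt_eqF.
  have -> : B * d ^+ 2 / (1 + t ^+ 2) = B * d / (1 + t ^+ 2) * d.
    by field; rewrite !gt_eqF.
  by rewrite ler_wpM2l// divr_ge0 ?mulr_ge0// ltW.
apply: (le_trans (ler_normB _ _)); apply: (le_trans (lerD h3 h4)).
by rewrite le_eqVlt; apply/orP; left; apply/eqP; ring.
Qed.

(** Makes the event that the rescaled sum is at most [x] an initial segment of the lattice, whose
    weight is then a partial sum. *)
Lemma lattice_cut (R : realType) (T : nat -> R) (x : R) (M : nat) :
  {homo T : i j / (i <= j)%N >-> i <= j} ->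
  exists2 n, (n <= M)%N & forall k, (k < M)%N -> (T k <= x) = (k < n)%N.
Proof.
move=> mT; elim: M => [|M [n nM IH]]; first by exists 0%N.
have [Tx|Tx] := leP (T M) x.
  exists M.+1 => // k kM; rewrite kM; apply: le_trans Tx; exact: mT.
exists n; first exact: leqW.
move=> k; rewrite ltnS leq_eqVlt => /predU1P[->|]; last exact: IH.
by rewrite leNgt Tx/=; apply/esym/negbTE; rewrite -leqNgt.
Qed.

(** Multiplied by [c * d], the partial sums of [v] follow the increments of [F] from [t0 - d] on,
    within [O(e)]. The full sum is therefore within [O(e)] of the total mass one, and the factor
    [c * d] cancels in the ratio. *)
Lemma lattice_clt (R : realType) (F : R -> R) (a c m del K eta : R) (q : nat) :
  0 < a -> 0 < c -> (0 < q)%N ->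
  (forall t : R, is_derive t 1 F (c * expR (- (a * t ^+ (2 * q))))) ->
  F y @[y --> +oo] --> (1 : R) -> F y @[y --> -oo] --> (0 : R) ->
  -1 < m < 1 -> 0 < del -> 0 <= K -> K * del <= a / 2 -> 0 < eta ->
  exists2 C : R, 0 < C & forall (N : nat) (e : R) (v u : nat -> R),
    (0 < N)%N -> 0 < e <= 1 / 2 -> e ^+ (2 * q) = N%:R^-1 -> C * e <= 1 / 2 ->
    (forall k, u k = k%:R * 2 / N%:R - 1 - m) ->
    (forall k, (k <= N)%N -> `|u k| <= del -> exists2 E : R,
       v k = expR (- (a * (N%:R * u k ^+ (2 * q))) + E) &
       `|E| <= K * (N%:R * `|u k| ^+ (2 * q).+1 + `|u k| + N%:R^-1)) ->
    (forall k, (k <= N)%N -> del < `|u k| ->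
       0 <= v k <= K * N%:R ^+ 4 * expR (- (eta * N%:R))) ->
    forall x : R,
    `|(\sum_(k < N.+1 | u k / e <= x) v k) / (\sum_(k < N.+1) v k) - F x| <= C * e.
Proof.
move=> a0 c0 q0 dF F1 F0 /andP[m1 m2] del0 K0 Kdel eta0.
have [mF F01 Flip [B B0 tail]] := cdf_bounds _ _ _ _ _ a0 c0 q0 dF F1 F0.
have [C1 C10 term] := weight_term _ _ _ _ _ _ _ _ a0 c0 q0 dF del0 K0 Kdel eta0.
(* The rescaled lattice ends at [- (1 + m) / e] and [(1 - m) / e], where the tail bound [B / t]
   becomes [Bm * e] and [Bp * e]. *)
have [Bm Bm0 BmE] : exists2 b : R, 0 < b & b = B / (1 + m).
  by eexists; last reflexivity; rewrite divr_gt0//; lra.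
have [Bp Bp0 BpE] : exists2 b : R, 0 < b & b = B / (1 - m).
  by eexists; last reflexivity; rewrite divr_gt0//; lra.
(* The summands bound the accumulated lattice error, the mass to the left of the lattice, and the
   distance from [F x] to the value of [F] at the last node counted. *)
pose C2 := c * (C1 * (3 * pi)) + Bm + (Bm + Bp + 2 * c).
have pi0 := @pi_gt0 R.
have C30 : 0 < c * (C1 * (3 * pi)) by rewrite !mulr_gt0.
have C20 : 0 < C2 by rewrite /C2; lra.
(* Numerator and denominator are each off by at most [C2 * e], and the denominator is at least
   [1 / 2]. *)
exists (4 * C2); first lra.
move=> N e v u N0 /andP[e0 e1] eN Ce uE vnear vfar x.
have n0 : 0 < N%:R :> R by rewrite ltr0n.
(* The mesh is [2 / (N * e) = 2 * e ^+ (2 * q - 1)], hence at most [2 * e]. *)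
have [d [dE d0 d1 de]] : exists d : R, [/\ d = 2 / N%:R / e, 0 < d, d <= 1 & d <= 2 * e].
  exists (2 / N%:R / e).
  have h0 : 0 < 2 / N%:R / e by rewrite !divr_gt0.
  have h1 : 2 / N%:R / e <= 2 * e.
    rewrite -eN ler_pdivrMr// -mulrA ler_wpM2l// -expr2 ler_wiXn2l//; last first.
      by clear -q0; lia.
    lra. exact: ltW.
  by split => //; lra.
pose t0 : R := (- 1 - m) / e.
have tE k : u k / e = t0 + k%:R * d by rewrite uE /t0 dE; field; rewrite !gt_eqF.
have u2 k : (k <= N)%N -> `|u k| <= 2.
  move=> kN; have : k%:R * 2 / N%:R <= 2 :> R.
    by rewrite ler_pdivrMr// mulrC ler_wpM2l// ler_nat.
  have : 0 <= k%:R * 2 / N%:R :> R by rewrite divr_ge0 ?mulr_ge0.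
  rewrite uE ler_norml => h1 h2; clear -h1 h2 m1 m2.
  by apply/andP; split; lra.
have d01 : 0 < d <= 1 by rewrite d0.
have partial n : (n <= N.+1)%N ->
  `|c * (d * \sum_(k < n) v k) - (F (t0 + n%:R * d - d) - F (t0 - d))|
     <= c * (C1 * (3 * pi)) * e.
  move=> nN.
  have -> : F (t0 + n%:R * d - d) - F (t0 - d) =
     c * \sum_(k < n) (F (u k / e) - F (u k / e - d)) / c.
    rewrite -mulr_suml mulrCA divff ?gt_eqF// mulr1.
    elim: n {nN} => [|n IH]; first by rewrite big_ord0 mul0r addr0 subrr.
    rewrite big_ord_recr/= -IH -natr1 tE.
    have -> : t0 + (n%:R + 1) * d - d = t0 + n%:R * d by ring.
    by ring.
  rewrite -mulrBr normrM (gtr0_norm c0) -[leRHS]mulrA ler_wpM2l ?(ltW c0)//.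
  rewrite mulr_sumr -sumrB.
  apply: (le_trans (ler_norm_sum _ _ _)).
  apply: (@le_trans _ _ (\sum_(k < n) C1 * e * (d / (1 + (t0 + k%:R * d) ^+ 2)))).
    apply: ler_sum => k _.
    have kN : (k <= N)%N by rewrite -ltnS (leq_trans _ nN).
    rewrite [d * _]mulrC -tE; apply: (term N) => //; first by rewrite e0.
    - exact: u2.
    - exact: vnear.
    - exact: vfar.
  rewrite -mulr_sumr.
  have -> : C1 * (3 * pi) * e = C1 * e * (3 * pi) by ring.
  by rewrite ler_wpM2l ?mulr_ge0 ?(ltW C10) ?(ltW e0)//; exact: sum_telescope_le.
have tN : t0 + N%:R * d = (1 - m) / e by rewrite /t0 dE; field; rewrite !gt_eqF.
have low : F t0 <= Bm * e.
  have h : 0 < (1 + m) / e by rewrite divr_gt0//; clear -m1; lra.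
  have [_] := tail _ h.
  have -> : - ((1 + m) / e) = t0 by rewrite /t0 -mulNr; congr (_ / _); ring.
  move=> /le_trans; apply; rewrite BmE le_eqVlt; apply/orP; left; apply/eqP.
  by field; rewrite !gt_eqF//; clear -m1 m2; lra.
have high : 1 - F (t0 + N%:R * d) <= Bp * e.
  have h : 0 < (1 - m) / e by rewrite divr_gt0//; clear -m2; lra.
  have [] := tail _ h; rewrite tN.
  move=> /le_trans h1 _; apply: h1; rewrite BpE le_eqVlt; apply/orP; left; apply/eqP.
  by field; rewrite !gt_eqF//; clear -m1 m2; lra.
have low' : 0 <= F (t0 - d) <= Bm * e.
  have /andP[-> _] := F01 (t0 - d).
  apply: le_trans low; apply: mF; clear -d0; lra.
have mT : {homo (fun k => u k / e) : i j / (i <= j)%N >-> i <= j}.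
  by move=> i j ij; rewrite !tE lerD2l ler_wpM2r ?ler_nat// ltW.
have [n nN cut] := lattice_cut _ _ x N.+1 mT.
have sumE : \sum_(k < N.+1 | u k / e <= x) v k = \sum_(k < n) v k.
  rewrite (big_ord_widen _ _ nN); apply: eq_bigl => k; exact: cut.
have Bme : 0 < Bm * e by exact: mulr_gt0.
have Bpe : 0 < Bp * e by exact: mulr_gt0.
have ce : 0 < c * e by exact: mulr_gt0.
have Fx : `|F (t0 + n%:R * d - d) - F x| <= (Bm + Bp + 2 * c) * e.
  have /andP[Fx0 Fx1] := F01 x; have /andP[Fn0 Fn1] := F01 (t0 + n%:R * d - d).
  (* Three positions of [x]: left of the whole lattice, beyond its last node, or between two
     consecutive nodes. *)
  case: n nN cut {sumE} Fn0 Fn1 => [|n] nN cut.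
    rewrite mul0r addr0 => _ _.
    have : F x <= F t0.
      apply: mF; apply: ltW; rewrite ltNge.
      have -> : t0 = u 0%N / e by rewrite tE mul0r addr0.
      by rewrite cut.
    move: low' => /andP[l1 l2] l3; rewrite ler_norml.
    by clear -l1 l2 l3 low Fx0 Bpe ce Bme; apply/andP; split; lra.
  have -> : t0 + n.+1%:R * d - d = t0 + n%:R * d by rewrite -natr1; ring.
  move=> Fn0 Fn1.
  have xn : F (t0 + n%:R * d) <= F x by apply: mF; rewrite -tE cut.
  move: nN; rewrite ltnS leq_eqVlt => /predU1P[nE|nN].
    rewrite nE in xn *; rewrite ler_norml.
    by clear -xn high Fx1 Bme Bpe ce; apply/andP; split; lra.
  have xn1 : F x <= F (t0 + n%:R * d + d).
    apply: mF; apply: ltW; rewrite ltNge.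
    have -> : t0 + n%:R * d + d = u n.+1 / e by rewrite tE -natr1; ring.
    by rewrite cut// ltnn.
  have h : F (t0 + n%:R * d + d) - F (t0 + n%:R * d) <= c * d.
    have -> : c * d = c * (t0 + n%:R * d + d - (t0 + n%:R * d)) by ring.
    by apply: Flip; rewrite lerDl ltW.
  have : c * d <= c * (2 * e) by rewrite ler_wpM2l// ltW.
  move=> cd; rewrite ler_norml.
  by clear -xn xn1 h cd Bme Bpe ce; apply/andP; split; lra.
have C2E : C2 * e = c * (C1 * (3 * pi)) * e + Bm * e + (Bm + Bp + 2 * c) * e.
  by rewrite /C2; ring.
have num : `|c * (d * \sum_(k < n) v k) - F x| <= C2 * e.
  have := partial n nN; move: Fx; move: low'; rewrite !ler_norml C2E.
  move=> /andP[l1 l2] /andP[l3 l4] /andP[l5 l6].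
  by clear -l1 l2 l3 l4 l5 l6; apply/andP; split; lra.
have den : `|c * (d * \sum_(k < N.+1) v k) - 1| <= C2 * e.
  have := partial N.+1 (leqnn _).
  have -> : t0 + N.+1%:R * d - d = t0 + N%:R * d by rewrite -natr1; ring.
  have /andP[_ h2] := F01 (t0 + N%:R * d).
  move: low'; rewrite !ler_norml C2E.
  move=> /andP[l1 l2] /andP[l3 l4].
  by clear -l1 l2 l3 l4 h2 high Bme Bpe ce; apply/andP; split; lra.
rewrite sumE; move: num den.
set X := \sum_(k < n) _; set Y := \sum_(k < N.+1) _ => num den.
have Y0 : 1 / 2 <= c * (d * Y).
  have C2e0 : 0 < C2 * e by rewrite mulr_gt0.
  by move: den; rewrite ler_norml => /andP[l1 l2]; clear -l1 Ce C2e0; lra.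
have cd0 : 0 < c * d by exact: mulr_gt0.
have -> : X / Y - F x = ((c * (d * X) - F x) - F x * (c * (d * Y) - 1)) / (c * (d * Y)).
  have Yn : Y != 0 by apply: contraTneq Y0 => ->; rewrite !mulr0 -ltNge; lra.
  by field; rewrite Yn !gt_eqF.
rewrite normrM normfV [`|c * (d * Y)|]gtr0_norm; last lra.
rewrite ler_pdivrMr; last lra.
have h1 : `|F x * (c * (d * Y) - 1)| <= C2 * e.
  have /andP[f0 f1] := F01 x.
  by rewrite normrM (ger0_norm f0) -[leRHS]mul1r; apply: ler_pM.
apply: (le_trans (ler_normB _ _)).
have h2 : 4 * C2 * e * (1 / 2) <= 4 * C2 * e * (c * (d * Y)).
  by rewrite ler_wpM2l// !mulr_ge0// ltW.
clear -num h1 h2; lra.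
Qed.

(** * Binomial weights *)

Lemma card_config_plus (N k : nat) :
  #|[set x : config N | #|[set i | x i]%SET| == k]%SET| = 'C(N, k).
Proof.
rewrite -[in RHS](card_ord N) -card_draws.
pose f (x : config N) : {set 'I_N} := [set i | x i]%SET.
have fI : injective f.
  by move=> x y /setP fxy; apply/ffunP => i; have := fxy i; rewrite !inE.
rewrite -(card_imset _ fI); apply: eq_card => A; rewrite inE.
apply/imsetP/idP => [[x]|/eqP Ak]; first by rewrite inE => + ->.
have fE : f [ffun i => i \in A] = A by apply/setP => i; rewrite !inE ffunE.
by exists [ffun i => i \in A]; rewrite ?inE -/(f _) fE ?Ak.
Qed.

Lemma SN_plus (R : realType) (N : nat) (x : config N) :
  SN x = (#|[set i | x i]%SET|%:R * 2 - N%:R :> R).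
Proof.
have spinE b : spin R b = b%:R * 2 - 1 by case: b; rewrite /spin ?mulr1n ?mulr0n; lra.
rewrite /SN (eq_bigr _ (fun i _ => spinE (x i))) sumrB -mulr_suml.
rewrite sumr_const card_ord -sum1_card natr_sum; congr (_ * _ - _).
by rewrite [in RHS]big_mkcond; apply: eq_bigr => i _; rewrite inE; case: (x i).
Qed.

Lemma sum_config (R : realType) (N : nat) (P : pred R) (f : R -> R) :
  \sum_(x : config N | P (SN x)) f (SN x) =
  \sum_(k < N.+1 | P (k%:R * 2 - N%:R)) 'C(N, k)%:R * f (k%:R * 2 - N%:R).
Proof.
pose g (x : config N) : 'I_N.+1 := inord #|[set i | x i]%SET|.
have gE x : (g x : nat) = #|[set i | x i]%SET|.
  by rewrite inordK// ltnS (leq_trans (max_card _))// card_ord.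
rewrite (partition_big g (fun k : 'I_N.+1 => P (k%:R * 2 - N%:R)))/=; last first.
  by move=> x; rewrite SN_plus gE.
apply: eq_bigr => k Pk.
rewrite (eq_bigl (fun x => x \in [set x : config N | #|[set i | x i]%SET| == k]%SET)); last first.
  move=> x; rewrite inE SN_plus -gE; apply/andP/eqP => [[_ /eqP->]//|gk].
  by rewrite gk; split => //; apply/eqP/val_inj.
rewrite (eq_bigr (fun=> f (k%:R * 2 - N%:R))); last first.
  by move=> x; rewrite inE SN_plus => /eqP ->.
rewrite sumr_const.
rewrite card_config_plus.
by rewrite [RHS]mulr_natl.
Qed.

(** The sum over [p]-tuples of indices, repetitions allowed, is the expansion of [SN x ^+ p]. *)
Lemma cw_energyE (R : realType) (beta h : R) (p N : nat) (x : config N) :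
  (0 < N)%N ->
  cw_energy beta h p x =
    N%:R * (beta * (SN x / N%:R) ^+ p + h * (SN x / N%:R)).
Proof.
move=> N0; have n0 : 0 < N%:R :> R by rewrite ltr0n.
rewrite /cw_energy.
have -> : \sum_(i : {ffun 'I_p -> 'I_N}) \prod_(k < p) spin R (x (i k)) = SN x ^+ p.
  rewrite /SN -[in RHS](card_ord p) -prodr_const bigA_distr_bigA.
  by apply: eq_bigr => i _; apply: eq_bigr => k _.
rewrite powRB; last by apply/implyP => _; rewrite gt_eqF.
rewrite powRr1 ?ltW// powR_mulrn ?ltW// expr_div_n.
by field; rewrite ?expf_neq0 ?gt_eqF.
Qed.

Lemma cw_Z_gt0 (R : realType) (beta h : R) (p N : nat) : 0 < cw_Z beta h p N.
Proof.
rewrite /cw_Z divr_gt0 ?exprn_gt0//.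
rewrite (bigD1 [ffun=> true])//= ltr_wpDr ?expR_gt0// sumr_ge0// => x _.
Qed.

Lemma cw_probE (R : realType) (beta h : R) (p N : nat) (E : pred (config N)) :
  cw_prob beta h p E =
  (\sum_(x : config N | E x) expR (cw_energy beta h p x)) / (2 ^+ N * cw_Z beta h p N).
Proof. by rewrite /cw_prob mulr_suml. Qed.

Lemma cw_prob_all (R : realType) (beta h : R) (p N : nat) (E : pred (config N)) :
  (forall x, E x) -> cw_prob beta h p E = 1.
Proof.
move=> ET; rewrite cw_probE (eq_bigl _ _ ET) -[X in X / _]/(\sum_(x : config N) _).
have Z0 := cw_Z_gt0 R beta h p N.
have -> : 2 ^+ N * cw_Z beta h p N = \sum_(x : config N) expR (cw_energy beta h p x).
  by rewrite /cw_Z mulrC divfK// expf_neq0.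
rewrite divff// gt_eqF// -(@pmulr_lgt0 _ (2 ^- N)) ?invr_gt0 ?exprn_gt0//.
Qed.

Lemma cw_cond_sum (R : realType) (beta h : R) (p N : nat) (E F : pred R) :
  (0 < N)%N ->
  cw_cond beta h p [pred x : config N | E (SN x)] [pred x : config N | F (SN x)] =
  let w (k : nat) := 'C(N, k)%:R * expR (N%:R *
     (beta * ((k%:R * 2 - N%:R) / N%:R) ^+ p + h * ((k%:R * 2 - N%:R) / N%:R))) in
  (\sum_(k < N.+1 | E (k%:R * 2 - N%:R) && F (k%:R * 2 - N%:R)) w k) /
  (\sum_(k < N.+1 | F (k%:R * 2 - N%:R)) w k).
Proof.
move=> N0; cbv zeta; rewrite /cw_cond !cw_probE.
have D0 : 2 ^+ N * cw_Z beta h p N != 0.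
  by rewrite mulf_neq0 ?expf_neq0// gt_eqF// cw_Z_gt0.
have cancel (X Y D : R) : D != 0 -> X / D / (Y / D) = X / Y.
  by move=> d0; rewrite invf_div mulrA divfK.
rewrite cancel//.
pose f (s : R) := expR (N%:R * (beta * (s / N%:R) ^+ p + h * (s / N%:R))).
rewrite (eq_bigr (fun x => f (SN x))); last by move=> x _; rewrite cw_energyE.
rewrite (sum_config _ _ (fun s => E s && F s)).
rewrite (eq_bigr (fun x => f (SN x))); last by move=> x _; rewrite cw_energyE.
by rewrite sum_config.
Qed.

(** Both bounds come from [ln (1 + z) <= z]: at [z = 1 / j], and at [z = - 1 / (j + 1)], where
    [1 + z] is the inverse of [1 + 1 / j]. *)
Lemma xlnDx_bounds (R : realType) (j : nat) :
  1 - (j.+1%:R)^-1 <= (j%:R : R) * ln (1 + (j%:R : R)^-1) <= 1.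
Proof.
case: j => [|j]; first by rewrite mul0r invr1 subrr lexx ler01.
have y0 : 0 < j.+1%:R :> R by rewrite ltr0n.
rewrite -[j.+2%:R]natr1; move: (j.+1%:R : R) y0 => y y0.
have yi : 0 < y^-1 by rewrite invr_gt0.
have h1 : ln (1 + y^-1) <= y^-1 by apply: le_ln1Dx; lra.
have h2 : ln (1 - (y + 1)^-1) <= - (y + 1)^-1.
  apply: le_ln1Dx; rewrite ltrN2 invf_lt1; lra.
have e2 : 1 - (y + 1)^-1 = (1 + y^-1)^-1 by field; apply/andP; split; lra.
move: h2; rewrite e2 lnV ?posrE; last lra.
rewrite lerN2 => h2; apply/andP; split.
  apply: (@le_trans _ _ (y * (y + 1)^-1)); last by rewrite ler_wpM2l// ltW.
  by rewrite -e2 le_eqVlt; apply/orP; left; apply/eqP; field; lra.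
by apply: (@le_trans _ _ (y * y^-1)); [rewrite ler_wpM2l// ltW|rewrite divff// gt_eqF].
Qed.

Lemma xlnx_step (R : realType) (s : R) (j : nat) : 0 < s ->
  j.+1%:R * ln (s * j.+1%:R) - j%:R * ln (s * j%:R) =
  ln s + ln j.+1%:R + j%:R * ln (1 + j%:R^-1).
Proof.
move=> s0; case: j => [|j].
  by rewrite !mul0r !mul1r mulr1 subr0 addr0 ln1 addr0.
have y0 : 0 < j.+1%:R :> R by rewrite ltr0n.
have -> : 1 + j.+1%:R^-1 = j.+2%:R / j.+1%:R :> R.
  by rewrite -[j.+2%:R]natr1; field; rewrite gt_eqF.
rewrite ln_div ?posrE ?ltr0n// !lnM ?posrE ?ltr0n// -[X in X * (_ + _)]natr1.
ring.
Qed.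

(* [log_ratio N k] compares [C(N,k)] with its entropy approximation
   [2 ^ N * exp (- N * I (2k/N - 1))]. *)
Definition log_ratio (R : realType) (N k : nat) : R :=
  ln 'C(N, k)%:R + N%:R * Ient (k%:R * 2 / N%:R - 1).

Lemma entropy_lattice (R : realType) (N k : nat) : (0 < N)%N -> (k <= N)%N ->
  N%:R * Ient (k%:R * 2 / N%:R - 1) =
  k%:R * ln (2 / N%:R * k%:R) + (N - k)%:R * ln (2 / N%:R * (N - k)%:R) :> R.
Proof.
move=> N0 kN; have n0 : 0 < N%:R :> R by rewrite ltr0n.
rewrite /Ient.
have -> : 1 + (k%:R * 2 / N%:R - 1) = 2 / N%:R * k%:R :> R by ring.
have -> : 1 - (k%:R * 2 / N%:R - 1) = 2 / N%:R * (N - k)%:R :> R.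
  by rewrite natrB//; field; rewrite gt_eqF.
by field; rewrite gt_eqF.
Qed.

(* The logarithms cancel, leaving [psi k - psi (N - k - 1)] for
   [psi j = j * ln (1 + 1 / j)], which lies in [1 - 1 / (j + 1), 1]. *)
Lemma log_ratio_step (R : realType) (N k : nat) : (k < N)%N ->
  - (k.+1%:R)^-1 <= log_ratio R N k.+1 - log_ratio R N k <= (N - k)%:R^-1.
Proof.
move=> kN; have N0 : (0 < N)%N by exact: leq_ltn_trans kN.
have n0 : 0 < N%:R :> R by rewrite ltr0n.
have s0 : 0 < 2 / N%:R :> R by rewrite divr_gt0.
have [j jE] : exists j, (N - k = j.+1)%N.
  by exists (N - k).-1; rewrite prednK// subn_gt0.
have jE' : (N - k.+1 = j)%N by rewrite subnS jE.
have binE : 'C(N, k.+1)%:R * k.+1%:R = 'C(N, k)%:R * j.+1%:R :> R.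
  by rewrite -!natrM -jE mulnC mul_bin_left mulnC.
have lnE : ln 'C(N, k.+1)%:R + ln k.+1%:R = ln 'C(N, k)%:R + ln j.+1%:R :> R.
  rewrite -!lnM ?posrE ?ltr0n ?bin_gt0 ?(ltnW kN)//; congr ln; exact: binE.
rewrite /log_ratio !entropy_lattice ?(ltnW kN)// jE jE'.
have h1 := xlnx_step R _ k s0; have h2 := xlnx_step R _ j s0.
have /andP[h3 h4] := xlnDx_bounds R k; have /andP[h5 h6] := xlnDx_bounds R j.
move: h3 h4 h5 h6; move: (k.+1%:R^-1) (j.+1%:R^-1) => kI jI h3 h4 h5 h6.
by apply/andP; split; lra.
Qed.

(** Turns the harmonic increments of [log_ratio_step] into differences of logarithms, which
    telescope. *)
Lemma invS_le_ln (R : realType) (j : nat) :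
  (j.+1%:R)^-1 <= 2 * (ln j.+2%:R - ln j.+1%:R) :> R.
Proof.
have y0 : 0 < j.+1%:R :> R by rewrite ltr0n.
rewrite -ln_div ?posrE ?ltr0n//.
have -> : j.+2%:R / j.+1%:R = 1 + j.+1%:R^-1 :> R.
  by rewrite -[j.+2%:R]natr1; field; rewrite gt_eqF.
have /andP[h _] := xlnDx_bounds R j.+1.
rewrite -(ler_pM2l y0) divff ?gt_eqF// mulrCA.
have : (j.+2%:R)^-1 <= 2^-1 :> R by rewrite lef_pV2 ?posrE ?ltr0n// ler_nat.
move: h; move: (j.+2%:R^-1) (_ * ln _) => a b h1 h2; lra.
Qed.

(** At [k = 0] the value is exactly [N * ln 2], and the increments add up to at most a logarithm.
    The induction keeps different upper and lower bounds, because the upward increments are governed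
    by [N - k] and the downward ones by [k.+1]. *)
Lemma log_ratio_bound (R : realType) (N k : nat) : (0 < N)%N -> (k <= N)%N ->
  `|log_ratio R N k - N%:R * ln 2| <= 2 * ln N.+1%:R.
Proof.
move=> N0 kN.
suff /andP[h1 h2] : - (2 * ln k.+1%:R) <= log_ratio R N k - N%:R * ln 2
    <= 2 * (ln N.+1%:R - ln (N - k).+1%:R).
  have h3 : 0 <= ln (N - k).+1%:R :> R by rewrite ln_ge0// ler1n.
  have h4 : ln k.+1%:R <= ln N.+1%:R :> R by rewrite ler_ln ?posrE ?ltr0n// ler_nat.
  by rewrite ler_norml; apply/andP; split; lra.
elim: k kN => [_|k IH kN].
  rewrite /log_ratio bin0 ln1 add0r entropy_lattice// mul0r add0r subn0.
  by rewrite divfK ?pnatr_eq0 -?lt0n// !subrr !mulr0 oppr0 lexx.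
have /andP[h1 h2] := IH (ltnW kN).
have /andP[h3 h4] := log_ratio_step R _ _ kN.
have h5 := invS_le_ln R k.
have [j jE] : exists j, (N - k = j.+1)%N.
  by exists (N - k).-1; rewrite prednK// subn_gt0.
have jE' : (N - k.+1 = j)%N by rewrite subnS jE.
rewrite jE in h2 h4; rewrite jE'; have h6 := invS_le_ln R j.
move: h3 h4 h5 h6; move: (k.+1%:R^-1) (j.+1%:R^-1) => kI jI h3 h4 h5 h6.
by apply/andP; split; lra.
Qed.

(** By [log_ratio_step] each increment is at most [1 / r] in absolute value. With [r] proportional
    to [N], the total is of the order of the distance between the two values of [2 k / N - 1]. *)
Lemma log_ratio_lipschitz (R : realType) (N k l : nat) (r : R) :
  0 < r -> (k <= l <= N)%N -> r <= k%:R -> r <= (N - l)%:R ->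
  `|log_ratio R N l - log_ratio R N k| <= (l - k)%:R / r.
Proof.
move=> r0 /andP[kl lN] rk; elim: l kl lN => [|l IH].
  by rewrite leqn0 => /eqP -> _ _; rewrite !subrr normr0 mul0r.
rewrite leq_eqVlt => /predU1P[->|]; first by rewrite subnn !subrr normr0 mul0r.
rewrite ltnS => kl lN rl.
have rl' : r <= (N - l)%:R by rewrite (le_trans rl)// ler_nat leq_sub.
have := IH kl (ltnW lN) rl'.
have /andP[h3 h4] := log_ratio_step R _ _ lN.
have h5 : (l.+1%:R)^-1 <= r^-1 :> R.
  by rewrite lef_pV2 ?posrE ?ltr0n// (le_trans rk)// ler_nat leqW.
have h6 : ((N - l)%:R)^-1 <= r^-1 :> R by rewrite lef_pV2 ?posrE// (lt_le_trans r0).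
rewrite subSn// -natr1 mulrDl mul1r !ler_norml.
move: h3 h4 h5 h6; move: (l.+1%:R^-1) ((N - l)%:R^-1) ((l - k)%:R / r) (r^-1).
move=> lI NI D rI h3 h4 h5 h6 /andP[h7 h8].
by apply/andP; split; lra.
Qed.

Lemma log_ratio_near (R : realType) (N k l : nat) (r : R) :
  0 < r -> (k <= N)%N -> (l <= N)%N ->
  r <= k%:R -> r <= (N - k)%:R -> r <= l%:R -> r <= (N - l)%:R ->
  `|log_ratio R N l - log_ratio R N k| <= `|l%:R - k%:R| / r.
Proof.
move=> r0; wlog kl : k l / (k <= l)%N => [th kN lN k1 k2 l1 l2|kN lN k1 k2 l1 l2].
  have [kl|/ltnW lk] := leqP k l; first exact: th.
  by rewrite distrC [X in _ <= X / _]distrC; exact: th.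
rewrite [X in _ <= X / _]ger0_norm ?subr_ge0 ?ler_nat// -natrB//.
by apply: log_ratio_lipschitz => //; rewrite kl.
Qed.

Lemma cw_weight_exp (R : realType) (beta h : R) (p N k : nat) :
  (0 < N)%N -> (k <= N)%N ->
  'C(N, k)%:R * expR (N%:R *
     (beta * ((k%:R * 2 - N%:R) / N%:R) ^+ p + h * ((k%:R * 2 - N%:R) / N%:R))) =
  expR (log_ratio R N k + N%:R * Hfun beta h p (k%:R * 2 / N%:R - 1)).
Proof.
move=> N0 kN; have n0 : 0 < N%:R :> R by rewrite ltr0n.
have -> : (k%:R * 2 - N%:R) / N%:R = k%:R * 2 / N%:R - 1 :> R.
  by field; rewrite gt_eqF.
rewrite /log_ratio /Hfun; set I := Ient _; set s := _ - 1.
have -> : ln 'C(N, k)%:R + N%:R * I + N%:R * (beta * s ^+ p + h * s - I) =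
    ln 'C(N, k)%:R + N%:R * (beta * s ^+ p + h * s) by ring.
by rewrite expRD lnK// posrE ltr0n bin_gt0.
Qed.

(** * Limit theorem near a maximizer *)

Lemma pow_root_le (R : realType) (e e0 : R) (n N : nat) :
  (0 < n)%N -> 0 <= e -> 0 < e0 -> e ^+ n = N%:R^-1 -> (e0 ^+ n)^-1 <= N%:R -> e <= e0.
Proof.
move=> n0 ege e00 eE h; rewrite leNgt; apply/negP => he.
have h1 : e0 ^+ n < e ^+ n by rewrite ltrXn2r ?nnegrE ?ltW// -?lt0n.
move: h1; rewrite eE ltNge => /negP; apply.
rewrite -[leRHS]invrK lef_pV2 ?posrE ?invr_gt0 ?exprn_gt0//.
by rewrite (lt_le_trans _ h)// invr_gt0 exprn_gt0.
Qed.

(** Dividing all weights by the one at a lattice point [k0] next to [m] leaves the conditional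
    probability unchanged and brings the weights into the form that [lattice_clt] expects. They are
    cut off outside [A], so that [gap] is asked for on [A] only. *)
Lemma curie_weiss_clt (R : realType) (beta h m a c K1 del0 : R) (p q : nat)
    (A : set R) (F : R -> R) :
  0 < a -> 0 < c -> (0 < q)%N ->
  (forall t : R, is_derive t 1 F (c * expR (- (a * t ^+ (2 * q))))) ->
  F y @[y --> +oo] --> (1 : R) -> F y @[y --> -oo] --> (0 : R) ->
  -1 < m < 1 -> 0 < del0 -> 0 <= K1 ->
  (forall u : R, `|u| <= del0 ->
     `|Hfun beta h p (m + u) - Hfun beta h p m + a * u ^+ (2 * q)|
       <= K1 * `|u| ^+ (2 * q).+1) ->
  nbhs m A ->
  (forall del : R, 0 < del -> exists2 eta : R, 0 < eta &
     forall y : R, -1 <= y <= 1 -> A y -> del < `|y - m| ->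
       Hfun beta h p y <= Hfun beta h p m - eta) ->
  exists (C : R) (N0 : nat), forall N : nat, (N0 <= N)%N -> forall e : R,
    0 < e -> e ^+ (2 * q) = N%:R^-1 -> forall x : R,
    `|cw_cond beta h p [pred X : config N | (SN X / N%:R - m) / e <= x]
        [pred X : config N | `[< A (SN X / N%:R) >]] - F x| <= C * e.
Proof.
move=> a0 c0 q0 dF F1 F0 /andP[m1 m2] del00 K10 taylor mA gap.
have [r r0 rA] : exists2 r : R, 0 < r & forall y, `|y - m| < r -> A y.
  move: mA => /nbhs_ballP[r /= r0 rA]; exists r => // y yr; apply: rA.
  by rewrite /ball/= distrC.
have nm : `|m| < 1 by rewrite ltr_norml m1.
(* If [|u| <= (1 - |m|) / 2], then [1 + m + u] and [1 - m - u] are at least [(1 - |m|) / 2]; their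
   halves are [k / N] and [(N - k) / N]. *)
have [al al0 alE] : exists2 al : R, 0 < al & al = (1 - `|m|) / 4.
  by eexists; last reflexivity; lra.
(* [K] has to cover the Taylor remainder, the prefactor of the far weights, and the variation of
   [log_ratio] together with the offset of the reference point from [m]. *)
have [K [K0 KE1 KE2 KE3]] : exists K : R, [/\ 0 < K, K1 <= K,
    16 * expR (4 * (a + K1)) <= K & 1 / (2 * al) + 1 / al + 4 * (a + K1) <= K].
  exists (K1 + (1 / (2 * al) + 1 / al + 4 * (a + K1)) + 16 * expR (4 * (a + K1))).
  have h1 : 0 < 1 / (2 * al) by rewrite divr_gt0// mulr_gt0.
  have h2 : 0 < 1 / al by rewrite divr_gt0.
  have h3 := expR_gt0 (4 * (a + K1)).
  by split; lra.
have [del [d0 d1 d2 d3 [d4 d5]]] : exists del : R, [/\ 0 < del, del <= del0, del <= 1,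
    del <= (1 - `|m|) / 2 & K * del <= a / 2 /\ del < r].
  exists (Num.min (Num.min del0 1) (Num.min ((1 - `|m|) / 2) (Num.min (a / 2 / K) (r / 2)))).
  have h1 : 0 < a / 2 / K by rewrite !divr_gt0.
  split; last split.
  - by rewrite !lt_min del00 ltr01 h1 /=; apply/andP; split; lra.
  - by rewrite !ge_min lexx.
  - by rewrite !ge_min lexx !orbT.
  - by rewrite !ge_min lexx !orbT.
  - by rewrite mulrC -ler_pdivlMr// !ge_min lexx !orbT.
  - apply: (@le_lt_trans _ _ (r / 2)); last lra.
    by rewrite !ge_min lexx !orbT.
have [eta eta0 etaP] := gap _ d0.
have m12 : -1 < m < 1 by rewrite m1.
have [C C0 main] := lattice_clt _ _ _ _ _ _ _ _ _ a0 c0 q0 dF F1 F0 m12 d0 (ltW K0) d4 eta0.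
have e00 : 0 < Num.min (1 / 2) (1 / (2 * C)).
  by rewrite lt_min !divr_gt0// mulr_gt0.
set e0 := Num.min _ _ in e00.
(* [N >= 2 / del] puts the reference point in the window [|u| <= del], and [N >= e0 ^- (2 * q)]
   forces [e <= e0]. *)
exists C, (Num.bound (2 / del) + Num.bound (e0 ^+ (2 * q))^-1 + 1)%N.
move=> N NN0 e ee eN x.
have N0 : (0 < N)%N by rewrite (leq_trans _ NN0)// addn1.
have n0 : 0 < N%:R :> R by rewrite ltr0n.
have n1 : 1 <= N%:R :> R by rewrite ler1n.
have Nd : 2 / N%:R <= del.
  rewrite ler_pdivrMr// mulrC -ler_pdivrMr//.
  apply: (le_trans (ltW (archi_boundP _))); first by rewrite divr_ge0// ltW.
  by rewrite ler_nat (leq_trans _ NN0)// -addnA leq_addr.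
have ee0 : e <= e0.
  apply: (pow_root_le _ _ _ _ _ _ (ltW ee) e00 eN); first by rewrite muln_gt0.
  apply: (le_trans (ltW (archi_boundP _))); first by rewrite invr_ge0 exprn_ge0// ltW.
  by rewrite ler_nat (leq_trans _ NN0)// addnAC leq_addl.
have e12 : 0 < e <= 1 / 2.
  by rewrite ee (le_trans ee0)// /e0 ge_min lexx.
have Ce : C * e <= 1 / 2.
  rewrite mulrC -ler_pdivlMr// (le_trans ee0)// /e0 ge_min.
  by apply/orP; right; rewrite le_eqVlt; apply/orP; left; apply/eqP; field; rewrite gt_eqF.
pose u (k : nat) : R := k%:R * 2 / N%:R - 1 - m.
pose H := Hfun beta h p; pose L := log_ratio R N.
have uH k : m + u k = k%:R * 2 / N%:R - 1 by rewrite /u; ring.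
have uk k : k%:R = N%:R * (1 + m + u k) / 2 by rewrite /u; field; rewrite gt_eqF.
have uk' k : (k <= N)%N -> (N - k)%:R = N%:R * (1 - m - u k) / 2.
  by move=> kN; rewrite natrB// /u; field; rewrite gt_eqF.
(* [z] is the real index of [m]. Rounding it down to [k0] moves the point by at most [2 / N], and as
   [H] is flat to order [2 * q >= 2] at [m], the value [N * (H (m + u k0) - H m)] is [O(1 / N)]. *)
pose z : R := N%:R * (1 + m) / 2.
have z0 : 0 <= z by rewrite /z divr_ge0// mulr_ge0//; clear -m1; lra.
have zN : z <= N%:R.
  by rewrite /z ler_pdivrMr// ler_wpM2l//; clear -m2; lra.
pose k0 := Num.truncn z.
have /andP[k01 k02] := truncn_itv z0; rewrite -/k0 in k01 k02.
have k0N : (k0 <= N)%N by rewrite -(ler_nat R) (le_trans k01).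
have u0 : `|u k0| <= 2 / N%:R.
  have h1 : u k0 = (k0%:R - z) * (2 / N%:R) by rewrite /u /z; field; rewrite gt_eqF.
  rewrite h1 normrM [`|2 / _|]gtr0_norm ?divr_gt0//.
  rewrite -[leRHS]mul1r ler_wpM2r//.
  by rewrite ler_norml; move: k02; rewrite -natr1 => k02; apply/andP; split; clear -k01 k02; lra.
have H0 : `|H (m + u k0) - H m| <= 4 * (a + K1) / N%:R / N%:R.
  have hd : `|u k0| <= del0 by clear -u0 Nd d1; lra.
  have := taylor _ hd; rewrite -/H => ht.
  have hp n : (2 <= n)%N -> `|u k0| ^+ n <= 4 / N%:R / N%:R.
    move=> n2; apply: (@le_trans _ _ (`|u k0| ^+ 2)).
      by rewrite ler_wiXn2l//; clear -u0 Nd d2; lra.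
    have -> : 4 / N%:R / N%:R = (2 / N%:R) ^+ 2 :> R by field; rewrite gt_eqF.
    by rewrite lerXn2r// nnegrE// divr_ge0// ltW.
  have hp1 := hp (2 * q)%N; have hp2 := hp (2 * q).+1.
  have h1 : `|a * u k0 ^+ (2 * q)| <= a * (4 / N%:R / N%:R).
    rewrite normrM (gtr0_norm a0) normrX ler_wpM2l ?(ltW a0)//; apply: hp1.
    by clear -q0; lia.
  have h2 : K1 * `|u k0| ^+ (2 * q).+1 <= K1 * (4 / N%:R / N%:R).
    by rewrite ler_wpM2l//; apply: hp2; clear -q0; lia.
  have -> : H (m + u k0) - H m =
     (H (m + u k0) - H m + a * u k0 ^+ (2 * q)) - a * u k0 ^+ (2 * q) by ring.
  apply: (le_trans (ler_normB _ _)).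
  have -> : 4 * (a + K1) / N%:R / N%:R = K1 * (4 / N%:R / N%:R) + a * (4 / N%:R / N%:R).
    by ring.
  by apply: lerD => //; exact: le_trans ht h2.
have NH0 : `|N%:R * (H (m + u k0) - H m)| <= 4 * (a + K1) / N%:R.
  rewrite normrM (gtr0_norm n0); apply: (le_trans (ler_wpM2l (ltW n0) H0)).
  by rewrite le_eqVlt; apply/orP; left; apply/eqP; field; rewrite gt_eqF.
pose W (k : nat) := L k + N%:R * H (m + u k).
pose v (k : nat) := if `[< A (m + u k) >] then expR (W k - W k0) else 0.
have central k : (k <= N)%N -> `|u k| <= del ->
    al * N%:R <= k%:R /\ al * N%:R <= (N - k)%:R.
  move=> kN; rewrite ler_norml => /andP[uk1 uk2].
  have := ler_norm m; have := ler_norm (- m); rewrite normrN => nm1 nm2.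
  by rewrite (uk' _ kN) (uk k) alE; split; rewrite mulrC -mulrA ler_wpM2l ?(ltW n0)//;
    clear -uk1 uk2 nm1 nm2 d3; lra.
have near_m k : (k <= N)%N -> `|u k| <= del -> exists2 E : R,
    v k = expR (- (a * (N%:R * u k ^+ (2 * q))) + E) &
    `|E| <= K * (N%:R * `|u k| ^+ (2 * q).+1 + `|u k| + N%:R^-1).
  move=> kN ud.
  exists (L k - L k0 + N%:R * (H (m + u k) - H m + a * u k ^+ (2 * q))
     - N%:R * (H (m + u k0) - H m)).
    rewrite /v; have -> : `[< A (m + u k) >] = true.
      by apply/asboolP; apply: rA; rewrite addrAC subrr add0r (le_lt_trans ud).
    by congr expR; rewrite /W; ring.
  have [c1 c2] := central _ kN ud.
  have [c3 c4] := central _ k0N (le_trans u0 Nd).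
  have alN : 0 < al * N%:R by exact: mulr_gt0.
  have h1 := log_ratio_near _ _ _ _ _ alN k0N kN c3 c4 c1 c2; rewrite -/L in h1.
  have h2 : `|k%:R - k0%:R| / (al * N%:R) <= `|u k| * (1 / (2 * al)) + N%:R^-1 * (1 / al).
    have -> : k%:R - k0%:R = N%:R / 2 * (u k - u k0) :> R.
      by rewrite (uk k) (uk k0); ring.
    rewrite normrM gtr0_norm ?divr_gt0//.
    have h3 : `|u k - u k0| <= `|u k| + 2 / N%:R.
      by apply: (le_trans (ler_normB _ _)); rewrite lerD2l.
    have -> : `|u k| * (1 / (2 * al)) + N%:R^-1 * (1 / al) =
       N%:R / 2 * (`|u k| + 2 / N%:R) / (al * N%:R).
      by field; rewrite !gt_eqF.
    by rewrite ler_wpM2r ?invr_ge0 ?(ltW alN)// ler_wpM2l// divr_ge0// ltW.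
  have h4 : `|N%:R * (H (m + u k) - H m + a * u k ^+ (2 * q))|
      <= K1 * (N%:R * `|u k| ^+ (2 * q).+1).
    rewrite normrM (gtr0_norm n0) mulrCA ler_wpM2l ?(ltW n0)//.
    by apply: taylor; exact: le_trans d1.
  apply: (le_trans (ler_normB _ _)).
  apply: (le_trans (lerD (ler_normD _ _) NH0)).
  apply: (le_trans (lerD (lerD (le_trans h1 h2) h4) (lexx _))).
  have nu := normr_ge0 (u k); have ni : 0 <= N%:R^-1 :> R by rewrite invr_ge0 ltW.
  have nup : 0 <= N%:R * `|u k| ^+ (2 * q).+1 by rewrite mulr_ge0 ?exprn_ge0// ltW.
  have i1 : 0 < 1 / (2 * al) by rewrite divr_gt0// mulr_gt0.
  have i2 : 0 < 1 / al by rewrite divr_gt0.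
  move: (1 / (2 * al)) (1 / al) (N%:R^-1) (`|u k|) (N%:R * _) i1 i2 nu ni nup KE3.
  move=> i j n w y i1 i2 nu ni nup KE3.
  have g1 : w * i <= w * K by rewrite ler_wpM2l//; clear -KE3 i1 i2 a0 K10; lra.
  have g2 : n * (j + 4 * (a + K1)) <= n * K by rewrite ler_wpM2l//; clear -KE3 i1; lra.
  have g3 : K1 * y <= K * y by rewrite ler_wpM2r.
  clear -g1 g2 g3; lra.
have far_m k : (k <= N)%N -> del < `|u k| ->
    0 <= v k <= K * N%:R ^+ 4 * expR (- (eta * N%:R)).
  move=> kN ud; rewrite /v.
  have K4 : 0 <= K * N%:R ^+ 4 * expR (- (eta * N%:R)).
    by rewrite !mulr_ge0 ?expR_ge0 ?exprn_ge0 ?(ltW K0) ?(ltW n0).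
  case: asboolP => [Ak|_]; last by rewrite lexx.
  rewrite expR_ge0/=.
  (* Two applications of [log_ratio_bound] give [4 * ln (N + 1)], the origin of the factor [N ^+ 4]
     in the far weights. *)
  have h1 : L k - L k0 <= 4 * ln N.+1%:R.
    have := log_ratio_bound R _ _ N0 kN; have := log_ratio_bound R _ _ N0 k0N.
    rewrite -/(L k) -/(L k0) !ler_norml => /andP[l1 l2] /andP[l3 l4].
    clear -l1 l2 l3 l4; lra.
  have h2 : H (m + u k) - H m <= - eta.
    rewrite lerBlDl; apply: etaP => //; last by rewrite addrAC subrr add0r.
    rewrite uH; have : k%:R * 2 / N%:R <= 2 :> R.
      by rewrite ler_pdivrMr// mulrC ler_wpM2l// ler_nat.
    have : 0 <= k%:R * 2 / N%:R :> R by rewrite divr_ge0 ?mulr_ge0.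
    by clear => *; apply/andP; split; lra.
  have h3 : - (N%:R * (H (m + u k0) - H m)) <= 4 * (a + K1).
    move: NH0; rewrite ler_norml => /andP[h3 _].
    have : 4 * (a + K1) / N%:R <= 4 * (a + K1).
      rewrite ler_pdivrMr// -[leLHS]mulr1 ler_wpM2l//; clear -a0 K10; lra.
    clear -h3; lra.
  have h4 : N%:R * (H (m + u k) - H m) <= N%:R * - eta by rewrite ler_wpM2l// ltW.
  have h5 : W k - W k0 <= 4 * ln N.+1%:R + 4 * (a + K1) - eta * N%:R.
    rewrite /W; clear -h1 h2 h3 h4; lra.
  have h6 : expR (4 * ln N.+1%:R) <= 16 * N%:R ^+ 4 :> R.
    rewrite expRM_natl lnK ?posrE ?ltr0n//.
    have -> : 16 * N%:R ^+ 4 = (2 * N%:R) ^+ 4 :> R by ring.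
    rewrite lerXn2r ?nnegrE ?mulr_ge0 ?ler0n// -natrM ler_nat; clear -N0; lia.
  apply: (@le_trans _ _ (expR (4 * ln N.+1%:R + 4 * (a + K1) - eta * N%:R))).
    by rewrite ler_expR.
  rewrite !expRD ler_wpM2r ?expR_ge0//.
  apply: (@le_trans _ _ (16 * N%:R ^+ 4 * expR (4 * (a + K1)))).
    by rewrite ler_wpM2r ?expR_ge0.
  rewrite mulrAC ler_wpM2r// exprn_ge0// ltW.
have := main N e v u N0 e12 eN Ce (fun k => erefl) near_m far_m x.
congr (_ <= _); congr (`|_ - _|).
have := cw_cond_sum R beta h p N (fun s => (s / N%:R - m) / e <= x)
   (fun s => `[< A (s / N%:R) >]) N0; rewrite /= => ->.
have xE (k : nat) : (k%:R * 2 - N%:R) / N%:R = m + u k.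
  by rewrite uH; field; rewrite gt_eqF.
have sumE (P : pred nat) :
  \sum_(k < N.+1 | P k && `[< A (m + u k) >]) 'C(N, k)%:R * expR (N%:R *
     (beta * ((k%:R * 2 - N%:R) / N%:R) ^+ p + h * ((k%:R * 2 - N%:R) / N%:R))) =
  expR (W k0) * \sum_(k < N.+1 | P k) v k.
  rewrite big_mkcondr mulr_sumr; apply: eq_bigr => k _; rewrite /v.
  case: ifP => _; last by rewrite mulr0.
  have kN : (k <= N)%N by rewrite -ltnS.
  by rewrite cw_weight_exp// -expRD -uH /W; congr expR; rewrite /L /H; ring.
have -> : (\sum_(k < N.+1 | u k / e <= x) v k) / (\sum_(k < N.+1) v k) =
   (expR (W k0) * \sum_(k < N.+1 | u k / e <= x) v k) /
   (expR (W k0) * \sum_(k < N.+1) v k).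
  by rewrite invfM mulrACA divff ?mul1r// gt_eqF// expR_gt0.
rewrite -(sumE (fun k => u k / e <= x)) -(sumE predT).
congr (_ / _); apply: eq_bigl => k; rewrite xE//.
by rewrite addrAC subrr add0r.
Qed.

(** * Local and global structure of H *)

Lemma is_derive_eq_val (R : realType) (f : R -> R) (x a b : R) :
  is_derive x 1 f a -> a = b -> is_derive x 1 f b.
Proof. by move=> + <-. Qed.

Lemma is_derive_scale (R : realType) (f : R -> R) (c x a : R) :
  is_derive x 1 f a -> is_derive x 1 (fun y : R => c * f y) (c * a).
Proof. exact: (@is_deriveZ R R R). Qed.

Lemma is_derive_affine (R : realType) (c s x : R) :
  is_derive x 1 (fun y : R => c + s * y) s.
Proof.
have h0 : is_derive x 1 (fun y : R => y) 1 by exact: is_derive_id.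
have h1 := @is_deriveZ R R R _ s x 1 _ h0.
have h2 := @is_deriveD R R R _ _ x 1 _ _ (is_derive_cst c x 1) h1.
by apply: is_derive_eq_val h2 _; rewrite /GRing.scale/= mulr1 add0r.
Qed.

Lemma is_derive_ln_affine (R : realType) (s x : R) : 0 < 1 + s * x ->
  is_derive x 1 (fun y : R => ln (1 + s * y)) (s * (1 + s * x)^-1).
Proof.
move=> sx; have h1 := is_derive_affine R 1 s x.
have h2 : is_derive (1 + s * x) 1 (@ln R) (1 + s * x)^-1 by exact: is_derive1_ln.
by rewrite mulrC; exact: (@is_derive1_comp R (@ln R) _ x).
Qed.

Lemma is_derive_inv_affine (R : realType) (s x : R) (k : nat) : 0 < 1 + s * x ->
  is_derive x 1 (fun y : R => ((1 + s * y)^-1) ^+ k)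
    (- (s * k%:R * ((1 + s * x)^-1) ^+ k.+1)).
Proof.
move=> sx; have h1 := is_derive_affine R 1 s x.
have n0 : 1 + s * x != 0 by rewrite gt_eqF.
have h2 : is_derive x 1 (fun y : R => (1 + s * y)^-1) (- (1 + s * x) ^- 2 *: s).
  exact: is_deriveV.
have h3 := @is_derive1_comp R (fun z => z ^+ k) _ x _ _ (is_derive_pow R k _) h2.
apply: is_derive_eq_val h3 _.
rewrite /GRing.scale/= -exprVn; case: k => [|k]; first by rewrite !mulr0 !mul0r oppr0.
by rewrite /= !exprS expr0; ring.
Qed.

(** Closed forms of the derivatives on [(-1, 1)]. The truncated subtraction [p - k.+2] is harmless,
    the falling factorial being 0 when [k.+2] exceeds [p]. The slopes [1] and [-1] stay visible so
    that one lemma on [1 + s * y] serves both logarithms. *)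
Definition Hder (R : realType) (beta h : R) (p k : nat) (x : R) : R :=
  match k with
  | 0 => Hfun beta h p x
  | 1 => beta * (p%:R * x ^+ p.-1) + h - 2^-1 * (ln (1 + 1 * x) - ln (1 + -1 * x))
  | k.+2 => beta * ((p ^_ k.+2)%:R * x ^+ (p - k.+2)) -
      2^-1 * (k`!)%:R * ((-1) ^+ k * ((1 + 1 * x)^-1) ^+ k.+1
                         + ((1 + -1 * x)^-1) ^+ k.+1)
  end.

Arguments Hder {R}.

Lemma is_derive_Hder (R : realType) (beta h : R) (p k : nat) (x : R) :
  -1 < x < 1 -> is_derive x 1 (Hder beta h p k) (Hder beta h p k.+1 x).
Proof.
move=> /andP[x1 x2].
have xp : 0 < 1 + 1 * x by lra.
have xm : 0 < 1 + -1 * x by lra.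
have lp := is_derive_ln_affine R 1 x xp.
have lm := is_derive_ln_affine R (-1) x xm.
case: k => [|[|k]].
- have h1 := is_derive_pow R p x.
  have h2 := is_derive_pow R 1 x.
  have E : Hder beta h p 0 = fun y : R => beta * y ^+ p + h * y -
     2^-1 * ((1 + y) * ln (1 + 1 * y) + (1 - y) * ln (1 + -1 * y)).
    by apply/funext => y; rewrite /Hder/= /Hfun /Ient mul1r mulN1r.
  rewrite E.
  have g1 : is_derive x 1 (fun y : R => beta * y ^+ p) (beta * (p%:R * x ^+ p.-1)).
    exact: is_derive_eq.
  have g2 : is_derive x 1 (fun y : R => h * y) (h * 1).
    by apply: is_derive_scale; exact: is_derive_id.
  have g3 : is_derive x 1 (fun y : R => 1 + y) 1.
    have := is_derive_affine R 1 1 x.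
    by congr is_derive; apply/funext => y; rewrite mul1r.
  have g4 : is_derive x 1 (fun y : R => 1 - y) (-1).
    have := is_derive_affine R 1 (-1) x.
    by congr is_derive; apply/funext => y; rewrite mulN1r.
  have g5 := @is_deriveM R R _ _ x 1 _ _ g3 lp.
  have g6 := @is_deriveM R R _ _ x 1 _ _ g4 lm.
  have g7 : is_derive x 1 (fun y : R => 2^-1 * ((1 + y) * ln (1 + 1 * y) + (1 - y) * ln (1 + -1 * y)))
     (2^-1 * (ln (1 + 1 * x) - ln (1 + -1 * x))).
    have g8 := @is_deriveZ R R R _ 2^-1 x 1 _ (@is_deriveD R R R _ _ x 1 _ _ g5 g6).
    apply: is_derive_eq_val g8 _.
    by rewrite /GRing.scale/=; field; lra.
  apply: is_derive_eq.
  by rewrite /Hder; ring.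
- have h1 := is_derive_pow R p.-1 x.
  rewrite /Hder.
  have g1 : is_derive x 1 (fun y : R => beta * (p%:R * y ^+ p.-1))
      (beta * (p%:R * (p.-1%:R * x ^+ p.-2))).
    apply: is_derive_scale; exact: is_derive_scale h1.
  have g2 : is_derive x 1 (fun y : R => 2^-1 * (ln (1 + 1 * y) - ln (1 + -1 * y)))
     (2^-1 * ((1 + 1 * x)^-1 + (1 + -1 * x)^-1)).
    have g8 := @is_deriveZ R R R _ 2^-1 x 1 _ (@is_deriveB R R R _ _ x 1 _ _ lp lm).
    apply: is_derive_eq_val g8 _.
    by rewrite /GRing.scale/=; ring.
  apply: is_derive_eq.
  rewrite fact0 !expr1 expr0 mulr1 !mul1r addr0 subn2; congr (_ - _); congr (_ * _).
  by rewrite ffactnS ffactn1 natrM mulrA.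
- rewrite /Hder.
  have h1 := is_derive_pow R (p - k.+2) x.
  have g1 : is_derive x 1 (fun y : R => beta * ((p ^_ k.+2)%:R * y ^+ (p - k.+2)))
      (beta * ((p ^_ k.+3)%:R * x ^+ (p - k.+3))).
    have -> : (p ^_ k.+3)%:R * x ^+ (p - k.+3) =
       (p ^_ k.+2)%:R * ((p - k.+2)%:R * x ^+ (p - k.+2).-1) :> R.
      by rewrite ffactnSr natrM -subnS mulrA.
    apply: is_derive_scale; exact: is_derive_scale h1.
  have ip := is_derive_inv_affine R 1 x k.+1 xp.
  have im := is_derive_inv_affine R (-1) x k.+1 xm.
  have g2 : is_derive x 1 (fun y : R => 2^-1 * (k`!)%:R * ((-1) ^+ k * ((1 + 1 * y)^-1) ^+ k.+1
                         + ((1 + -1 * y)^-1) ^+ k.+1))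
     (2^-1 * ((k.+1)`!)%:R * ((-1) ^+ k.+1 * ((1 + 1 * x)^-1) ^+ k.+2
                         + ((1 + -1 * x)^-1) ^+ k.+2)).
    have g3 := @is_deriveZ R R R _ ((-1) ^+ k) x 1 _ ip.
    have g8 := @is_deriveZ R R R _ (2^-1 * (k`!)%:R) x 1 _ (@is_deriveD R R R _ _ x 1 _ _ g3 im).
    apply: is_derive_eq_val g8 _.
    by rewrite /GRing.scale/= factS natrM [(-1) ^+ k.+1]exprS; ring.
  exact: is_derive_eq.
Qed.

Lemma derive1n_Hfun (R : realType) (beta h : R) (p k : nat) (x : R) :
  -1 < x < 1 -> derive1n k (Hfun beta h p) x = Hder beta h p k x.
Proof.
elim: k x => [//|k IH] x x1; rewrite derive1nS derive1E.
have d := is_derive_Hder R beta h p k x x1.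
rewrite (@near_eq_derive R R R _ (Hder beta h p k)) ?oner_eq0//.
  exact: derive_val.
have : \forall y \near x, y \in `]-1, 1[ by apply: near_in_itvoo; rewrite in_itv.
by apply: filterS => y; rewrite in_itv => /IH.
Qed.

(** The expansion is built from the top: [base] bounds the variation of [D n], and each lower order
    is one use of [MVT_norm]. The intermediate derivatives vanish at [m], so that only the term of
    order [n] is left. *)
Lemma taylor_critical (R : realType) (D : nat -> R -> R) (m d K : R) (n : nat) :
  (0 < n)%N -> 0 <= K ->
  (forall k (u : R), (k <= n)%N -> `|u| <= d ->
     is_derive (m + u) 1 (D k) (D k.+1 (m + u))) ->
  (forall k, (0 < k < n)%N -> D k m = 0) ->
  (forall u : R, `|u| <= d -> `|D n.+1 (m + u)| <= K) ->
  forall u : R, `|u| <= d ->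
    `|D 0 (m + u) - D 0 m - D n m / n`!%:R * u ^+ n| <= K * `|u| ^+ n.+1.
Proof.
move=> n0 K0 dD D0 DK.
have shift k (u : R) : (k <= n)%N -> `|u| <= d ->
    is_derive u 1 (fun u => D k (m + u)) (D k.+1 (m + u)).
  move=> kn ud; have h1 : is_derive u 1 (fun u : R => m + u) 1.
    have := is_derive_affine R m 1 u.
    by congr is_derive; apply/funext => y; rewrite mul1r.
  by have := @is_derive1_comp R (D k) _ u _ _ (dD k u kn ud) h1; rewrite mulr1.
have base u : `|u| <= d -> `|D n (m + u) - D n m| <= K * `|u| ^+ 1.
  move=> ud; apply: (MVT_norm _ (fun u => D n (m + u) - D n m)
    (fun u => D n.+1 (m + u)) K d u 0) => //; first by rewrite addr0 subrr.
  move=> x xd; split; last by rewrite expr0 mulr1 DK.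
  have h := shift n x (leqnn n) xd.
  by apply: is_derive_eq; rewrite ?subr0.
suff step j : (j < n)%N -> forall u : R, `|u| <= d ->
    `|D (n - j.+1)%N (m + u) - D (n - j.+1)%N m - D n m / (j.+1)`!%:R * u ^+ j.+1|
      <= K * `|u| ^+ j.+2.
  move=> u ud; have := step n.-1; rewrite prednK// subnn; exact.
elim: j => [|j IH] jn u ud.
  apply: (MVT_norm _ (fun u => D (n - 1)%N (m + u) - D (n - 1)%N m - D n m / (1)`!%:R * u ^+ 1)
    (fun u => D n (m + u) - D n m) K d u 1) => //.
    by rewrite addr0 subrr expr1 mulr0 subr0.
  move=> x xd; split; last exact: base.
  have h := shift (n - 1)%N x (leq_subr _ _) xd; rewrite subn1 prednK// in h.
  have h2 := is_derive_pow R 1 x.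
  have h3 : is_derive x 1 (fun u : R => D n m / (1)`!%:R * u ^+ 1)
     (D n m / (1)`!%:R * (1%:R * x ^+ 0)) by exact: is_derive_eq.
  rewrite subn1; apply: is_derive_eq.
  by rewrite factS fact0 muln1 expr0; field.
apply: (MVT_norm _ (fun u => D (n - j.+2)%N (m + u) - D (n - j.+2)%N m - D n m / (j.+2)`!%:R * u ^+ j.+2)
    (fun u => D (n - j.+1)%N (m + u) - D n m / (j.+1)`!%:R * u ^+ j.+1) K d u j.+2) => //.
  by rewrite addr0 subrr expr0n mulr0 subr0.
move=> x xd; split.
  have := shift (n - j.+2)%N x (leq_subr _ _) xd; rewrite (subnSK jn) => h.
  have h2 := is_derive_pow R j.+2 x.
  have h3 : is_derive x 1 (fun u : R => D n m / (j.+2)`!%:R * u ^+ j.+2)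
     (D n m / (j.+2)`!%:R * (j.+2%:R * x ^+ j.+1)) by exact: is_derive_eq.
  apply: is_derive_eq.
  have f0 : (j.+1)`!%:R != 0 :> R by rewrite pnatr_eq0 -lt0n fact_gt0.
  have f1 : 2 + j%:R != 0 :> R by rewrite -natrD pnatr_eq0.
  rewrite [(j.+2)`!]factS natrM subr0; congr (_ - _); field.
  by rewrite f0 f1.
(* [D (n - j.+1) m] vanishes, as its order lies strictly between 0 and [n]. *)
have := IH (ltnW jn) x xd; rewrite D0 ?subr0//.
by rewrite subn_gt0 jn/= ltn_subrL n0.
Qed.

Lemma Hder_locally_bounded (R : realType) (beta h : R) (p k : nat) (m : R) :
  -1 < m < 1 -> exists d K : R, [/\ 0 < d, 0 <= K & forall u : R, `|u| <= d ->
     -1 < m + u < 1 /\ `|Hder beta h p k (m + u)| <= K].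
Proof.
move=> m1.
have dH := is_derive_Hder R beta h p k m m1.
have cH : {for m, continuous (Hder beta h p k)}.
  by apply: differentiable_continuous; apply/derivable1_diffP; exact: (@ex_derive _ _ _ _ _ _ _ dH).
have n1 : \forall y \near m, `|Hder beta h p k y| < `|Hder beta h p k m| + 1.
  apply: (cvgr_norm_lt _ cH); rewrite ltrDl//.
have n2 : \forall y \near m, y \in `]-1, 1[ by apply: near_in_itvoo; rewrite in_itv.
have n12 : nbhs m (fun y => `|Hder beta h p k y| < `|Hder beta h p k m| + 1 /\
    y \in `]-1, 1[) by exact: filterI.
move: n12 => /nbhs_ballP[r /= r0 rP].
exists (r / 2), (`|Hder beta h p k m| + 1); split; first exact: divr_gt0.
  exact: addr_ge0.
move=> u ur; have [|h1 h2] := rP (m + u).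
  rewrite /ball/= opprD addrA subrr sub0r normrN; lra.
by split; [move: h2; rewrite in_itv|exact: ltW].
Qed.

Lemma Hfun_taylor (R : realType) (beta h : R) (p n : nat) (m : R) :
  -1 < m < 1 -> (0 < n)%N -> (forall k, (0 < k < n)%N -> Hder beta h p k m = 0) ->
  exists d K : R, [/\ 0 < d, 0 <= K & forall u : R, `|u| <= d ->
    -1 < m + u < 1 /\
    `|Hfun beta h p (m + u) - Hfun beta h p m - Hder beta h p n m / n`!%:R * u ^+ n|
      <= K * `|u| ^+ n.+1].
Proof.
move=> m1 n0 crit.
have [d [K [d0 K0 dK]]] := Hder_locally_bounded R beta h p n.+1 m m1.
exists d, K; split=> // u ud; split; first by have [] := dK u ud.
apply: (taylor_critical R (Hder beta h p) m d K n) => //.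
- by move=> k v kn vd; apply: is_derive_Hder; have [] := dK v vd.
- by move=> v vd; have [] := dK v vd.
Qed.

(** * Derivatives at a global maximizer *)

Lemma max_coef_le0 (R : realType) (f : R -> R) (b d K : R) (n : nat) :
  0 < d -> 0 <= K -> (forall u : R, `|u| <= d -> f u <= 0) ->
  (forall u : R, `|u| <= d -> `|f u - b * u ^+ n| <= K * `|u| ^+ n.+1) -> b <= 0.
Proof.
move=> d0 K0 f0 fb; rewrite leNgt; apply/negP => b0.
(* For [0 < u <= b / (2 * (K + 1))] the remainder is below half of the leading term, which would
   make [f u] positive. *)
have K10 : 0 < 2 * (K + 1) by lra.
have bK : 0 < b / (2 * (K + 1)) by exact: divr_gt0.
have [u [u0 ud ub]] : exists u : R, [/\ 0 < u, u <= d & u <= b / (2 * (K + 1))].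
  exists (Num.min d (b / (2 * (K + 1)))).
  by rewrite lt_min d0 bK !ge_min !lexx orbT.
have ud' : `|u| <= d by rewrite gtr0_norm.
have un : 0 < u ^+ n by exact: exprn_gt0.
have h1 := f0 u ud'; have := fb u ud'.
rewrite (gtr0_norm u0) ler_norml exprSr => /andP[h2 _].
have h3 : b * u ^+ n <= K * u * u ^+ n by lra.
rewrite ler_pM2r// in h3.
have h4 : K * u <= K * (b / (2 * (K + 1))) by rewrite ler_wpM2l.
have h5 : (K + 1) * (b / (2 * (K + 1))) = b / 2 by field; lra.
lra.
Qed.

(** For odd [n], reflecting [u] changes the sign of the leading coefficient, so both signs are
    excluded. *)
Lemma max_odd_coef (R : realType) (f : R -> R) (b d K : R) (n : nat) : odd n ->
  0 < d -> 0 <= K -> (forall u : R, `|u| <= d -> f u <= 0) ->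
  (forall u : R, `|u| <= d -> `|f u - b * u ^+ n| <= K * `|u| ^+ n.+1) -> b = 0.
Proof.
move=> on d0 K0 f0 fb; apply/eqP; rewrite eq_le (max_coef_le0 _ _ _ _ _ _ d0 K0 f0 fb)/=.
rewrite -oppr_le0; apply: (max_coef_le0 _ (fun u => f (- u)) _ _ _ n d0 K0).
  by move=> u ud; apply: f0; rewrite normrN.
move=> u ud; have := fb (- u); rewrite normrN => /(_ ud).
by rewrite exprNn -signr_odd on expr1 mulN1r mulrN mulNr.
Qed.

Lemma gmax_interior_derivatives (R : realType) (beta h : R) (p : nat) (m : R) :
  -1 < m < 1 -> is_gmax beta h p m ->
  [/\ Hder beta h p 1 m = 0, Hder beta h p 2 m <= 0 &
      Hder beta h p 2 m = 0 -> Hder beta h p 3 m = 0].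
Proof.
move=> m1 [_ mmax].
have max_le n d u : (forall u : R, `|u| <= d -> -1 < m + u < 1 /\ n u) -> `|u| <= d ->
    Hfun beta h p (m + u) - Hfun beta h p m <= 0.
  move=> H ud; have [/andP[h1 h2] _] := H u ud.
  by rewrite subr_le0; apply: mmax; rewrite !ltW.
have D1 : Hder beta h p 1 m = 0.
  have [//|k|d [K [d0 K0 T]]] := Hfun_taylor R beta h p 1 m m1.
    by case: k.
  have := max_odd_coef _ _ _ _ _ 1 isT d0 K0 (fun u => max_le _ d u T) (fun u ud => (T u ud).2).
  by rewrite factS fact0 muln1 divr1.
have D2 : Hder beta h p 2 m <= 0.
  have [//|k|d [K [d0 K0 T]]] := Hfun_taylor R beta h p 2 m m1.
    by case: k => [|[|]].
  have := max_coef_le0 _ _ _ _ _ 2 d0 K0 (fun u => max_le _ d u T) (fun u ud => (T u ud).2).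
  by rewrite pmulr_lle0// invr_gt0 ltr0n fact_gt0.
split => // D20.
have [//|k|d [K [d0 K0 T]]] := Hfun_taylor R beta h p 3 m m1.
  by case: k => [|[|[|]]].
have := max_odd_coef _ _ _ _ _ 3 isT d0 K0 (fun u => max_le _ d u T) (fun u ud => (T u ud).2).
move=> /eqP; rewrite mulf_eq0 invr_eq0 pnatr_eq0 => /orP[/eqP//|].
by rewrite -leqn0 leqNgt fact_gt0.
Qed.

(** * Continuity of [H], the gap below its maximum, and the position of its maximizers *)

Lemma Ient_even (R : realType) (x : R) : Ient (- x) = Ient x.
Proof. by rewrite /Ient opprK addrC. Qed.

(** As [ln] is 0 on nonpositive numbers, only the point 0 is delicate. For small [y > 0] and
    [s = sqrt y], [|y * ln y| = 2 * s * (s * - ln s)], and [s * - ln s < 1] because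
    [ln (1 / s) < 1 / s]. *)
Lemma continuous_xlnx (R : realType) : continuous (fun x : R => x * ln x).
Proof.
move=> x; have [x0|x0|->] := ltgtP x 0.
- have n0 : \forall y \near x, y * ln y = 0.
    have : \forall y \near x, y < 0 by exact: lt_nbhsl.
    by apply: filterS => y y0; rewrite ln0 ?mulr0// ltW.
  rewrite /prop_for /continuous_at ln0 ?(ltW x0)// mulr0.
  exact: cvg_near_cst.
- apply: (@continuousM R R id (@ln R) x); first exact: cvg_id.
  exact: continuous_ln.
- rewrite /prop_for /continuous_at mul0r; apply/cvgr0Pnorm_lt => e e0.
  have d0 : 0 < Num.min 1 ((e / 2) ^+ 2).
    by rewrite lt_min ltr01 exprn_gt0// divr_gt0.
  apply: filterS (nbhsx_ballx (0 : R) _ d0) => y; rewrite /ball/= sub0r normrN.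
  rewrite lt_min => /andP[y1 ye].
  have [y0|y0] := leP y 0; first by rewrite ln0// mulr0 normr0.
  rewrite (gtr0_norm y0) in y1 ye.
  have s0 : 0 < Num.sqrt y by rewrite sqrtr_gt0.
  have sE : y = Num.sqrt y ^+ 2 by rewrite sqr_sqrtr// ltW.
  have se : Num.sqrt y < e / 2.
    by rewrite -(@ltr_pXn2r _ 2) ?nnegrE ?ltW ?divr_gt0// -sE.
  have h1 : - ln (Num.sqrt y) < (Num.sqrt y)^-1.
    by rewrite -lnV ?posrE//; apply: ln_sublinear; rewrite invr_gt0.
  have h2 : ln y <= 0 by rewrite ln_le0// ltW.
  rewrite normrM (gtr0_norm y0) ler0_norm//.
  rewrite [X in ln X]sE lnXn// mulr2n.
  rewrite [X in X * _]sE expr2.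
  have h3 : Num.sqrt y * - ln (Num.sqrt y) < 1.
    by rewrite -(divff (lt0r_neq0 s0)) ltr_pM2l.
  have h4 : Num.sqrt y * (Num.sqrt y * - ln (Num.sqrt y)) < Num.sqrt y * 1.
    by rewrite ltr_pM2l.
  lra.
Qed.

Lemma continuous_Hfun (R : realType) (beta h : R) (p : nat) :
  continuous (Hfun beta h p).
Proof.
move=> x.
have c1 : {for x, continuous (fun y : R => beta * y ^+ p)}.
  apply: continuousM; first exact: cst_continuous.
  exact: exprn_continuous.
have c2 : {for x, continuous (fun y : R => h * y)}.
  apply: continuousM; first exact: cst_continuous.
  exact: cvg_id.
have c3 : {for x, continuous (fun y : R => (1 + y) * ln (1 + y))}.
  apply: (@continuous_comp _ _ _ (fun y : R => 1 + y) (fun z : R => z * ln z)).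
    by apply: continuousD; [exact: cst_continuous|exact: cvg_id].
  exact: continuous_xlnx.
have c4 : {for x, continuous (fun y : R => (1 - y) * ln (1 - y))}.
  apply: (@continuous_comp _ _ _ (fun y : R => 1 - y) (fun z : R => z * ln z)).
    by apply: continuousB; [exact: cst_continuous|exact: cvg_id].
  exact: continuous_xlnx.
have c5 : {for x, continuous (fun y : R =>
    2^-1 * ((1 + y) * ln (1 + y) + (1 - y) * ln (1 - y)))}.
  apply: continuousM; first exact: cst_continuous.
  exact: continuousD c3 c4.
exact: continuousB (continuousD c1 c2) c5.
Qed.

(** [H] attains a maximum on the compact part of [closure A] in [[-1, 1]] outside the ball of radius
    [del]. Were it as large as [H m], a second global maximizer would lie in [closure A]. *)
Lemma gap_away_from_max (R : realType) (beta h : R) (p : nat) (m : R) (A : set R) :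
  is_gmax beta h p m ->
  (forall y, is_gmax beta h p y -> closure A y -> y = m) ->
  forall del : R, 0 < del -> exists2 eta : R, 0 < eta &
     forall y : R, -1 <= y <= 1 -> A y -> del < `|y - m| ->
       Hfun beta h p y <= Hfun beta h p m - eta.
Proof.
move=> gm uniq del d0.
pose K := (closure A `&` ~` ball m del) `&` `[-1, 1].
have KP y : -1 <= y <= 1 -> A y -> del < `|y - m| -> K y.
  move=> y1 Ay yd; split; last by rewrite /= in_itv.
  split; first exact: subset_closure.
  by rewrite /ball/= distrC => /(lt_trans yd); rewrite ltxx.
have cK : compact K.
  rewrite /K setIC; apply: compact_closedI; first exact: segment_compact.
  apply: closedI; first exact: closed_closure.
  apply: open_closedC; exact: ball_open.
have [KE|/set0P K0] := eqVneq K set0.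
  by exists 1 => // y y1 Ay yd; have := KP y y1 Ay yd; rewrite KE.
have [c] := compact_EVT_max K0 cK (continuous_subspaceT (continuous_Hfun R beta h p)).
rewrite inE => -[[cA cd]]; rewrite /= in_itv/= => c1 cmax.
exists (Hfun beta h p m - Hfun beta h p c).
  rewrite subr_gt0 ltNge; apply/negP => mc.
  have cm : c = m.
    apply: uniq => //; split => // y y1.
    by apply: le_trans mc; exact: (gm.2).
  by apply: cd; rewrite cm; exact: ballxx.
by move=> y y1 Ay yd; rewrite subKr; apply: cmax; rewrite inE; exact: KP.
Qed.

(** Reflection excludes [m < 0], since [h > 0] and the entropy is even; the infinite slope of the
    entropy excludes [m = 1]; and [m = 0] is not stationary, the derivative there being [h]. *)
Lemma gmax_in_01 (R : realType) (beta h : R) (p : nat) (m : R) :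
  (3 <= p)%N -> 0 < beta -> 0 < h -> is_gmax beta h p m -> 0 < m < 1.
Proof.
move=> p3 b0 h0 gm; have [/andP[m1 m2] mmax] := gm.
have m_ge0 : 0 <= m.
  rewrite leNgt; apply/negP => mneg.
  have := mmax (- m); rewrite lerNl opprK lerNl m1 m2 => /(_ isT).
  rewrite /Hfun Ient_even lerD2r leNgt => /negP; apply.
  have h1 : m ^+ p <= (- m) ^+ p.
    by rewrite -(ltr0_norm mneg) -normrX ler_norm.
  have h2 : beta * m ^+ p <= beta * (- m) ^+ p by rewrite ler_wpM2l// ltW.
  have h3 : h * m < h * - m by rewrite ltr_pM2l//; lra.
  exact: ler_ltD.
have m_lt1 : m < 1.
  rewrite lt_neqAle m2 andbT; apply/eqP => mE; rewrite {m m1 m2 m_ge0}mE in gm mmax.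
  (* On [(1 - expR (- L), 1)] the entropy has slope above [L / 2], which exceeds the bound
     [beta * p + h] on the slope of the other terms. *)
  pose L := 2 * (beta * p%:R + h) + 1.
  have L0 : 0 < L by rewrite /L ltr_wpDl// mulr_ge0// addr_ge0 ?mulr_ge0// ltW.
  pose x := 1 - expR (- L).
  have e0 := expR_gt0 (- L).
  have e1 : expR (- L) < 1 by rewrite expR_lt1 oppr_lt0.
  have x1 : x < 1 by rewrite /x; lra.
  have x0 : 0 < x by rewrite /x; lra.
  have cH : {within `[x, 1], continuous (Hfun beta h p)}.
    exact: continuous_subspaceT (continuous_Hfun R beta h p).
  have dH (y : R) : y \in `]x, 1[ -> is_derive y 1 (Hfun beta h p) (Hder beta h p 1 y).
    rewrite in_itv/= => /andP[xy y1]; apply: (is_derive_Hder R beta h p 0).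
    by rewrite y1 andbT; lra.
  have [c] := MVT x1 dH cH; rewrite in_itv/= => /andP[xc c1] E.
  have c0 : 0 < c by exact: lt_trans xc.
  have Dneg : Hder beta h p 1 c < 0.
    rewrite /Hder mul1r mulN1r.
    have l1 : ln (1 - c) < - L.
      rewrite -[- L]expRK ltr_ln ?posrE//; last by lra.
      by rewrite /x in xc; lra.
    have l2 : 0 <= ln (1 + c) by rewrite ln_ge0//; lra.
    have l3 : p%:R * c ^+ p.-1 <= p%:R * 1 :> R.
      by rewrite ler_wpM2l// exprn_ile1 ?ltW.
    have l4 : beta * (p%:R * c ^+ p.-1) <= beta * (p%:R * 1) by rewrite ler_wpM2l// ltW.
    rewrite /L in l1; lra.
  have : Hfun beta h p x <= Hfun beta h p 1 by apply: mmax; apply/andP; split; lra.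
  rewrite -subr_ge0 E leNgt nmulr_rlt0// subr_gt0 x1//.
rewrite m_lt1 andbT lt_neqAle m_ge0 andbT; apply/eqP => mE.
have m01 : -1 < m < 1 by rewrite m_lt1 andbT; lra.
have [+ _ _] := gmax_interior_derivatives R beta h p m m01 gm.
rewrite /Hder -mE; move: p3; case: p {gm mmax} => [|[|p]]// _.
rewrite /= expr0n/= !mulr0 add0r addr0 subrr mulr0 subr0 => h00.
by rewrite h00 ltxx in h0.
Qed.

(* For [m] in (0, 1), [Hder 2] and [Hder 3] both vanish only where
   [x ^+ (p - 2) * (1 - x ^+ 2)] is stationary, i.e. at [m ^+ 2 = (p - 2) / p]. *)
Lemma degenerate_point (R : realType) (beta h : R) (n : nat) (m : R) :
  0 < m < 1 -> Hder beta h n.+3 2 m = 0 -> Hder beta h n.+3 3 m = 0 ->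
  n.+1%:R * (1 - m ^+ 2) = 2 * m ^+ 2 /\ Hder beta h n.+3 4 m < 0.
Proof.
move=> /andP[m0 m1].
have p0 : 0 < 1 + m by lra.
have q0 : 0 < 1 - m by lra.
have s0 : 0 < 1 - m ^+ 2.
  have -> : 1 - m ^+ 2 = (1 + m) * (1 - m) by ring.
  exact: mulr_gt0.
rewrite /Hder !subSS subn0 subn1 /= mul1r mulN1r.
rewrite !ffactnSr !ffactn0 mul1n subn0 !subSS !subn0.
(* [T] is a common factor: the power terms of the second and third derivatives are [T * m] and
   [T * n.+1], and that of the fourth, multiplied by [m], is [T * n.+1 * n]. *)
set T := beta * ((n.+3 * n.+2)%:R * m ^+ n).
have pE : beta * ((n.+3 * n.+2)%:R * m ^+ n.+1) = T * m by rewrite /T exprS; ring.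
have -> : beta * ((n.+3 * n.+2 * n.+1)%:R * m ^+ n) = T * n.+1%:R.
  by rewrite natrM /T; ring.
rewrite pE !factS fact0 !muln1 expr1 expr0 => D2 D3.
have E2 : T * m * (1 - m ^+ 2) = 1.
  have : T * m = 2^-1 * 1 * (1 * (1 + m)^-1 + (1 - m)^-1) by move: D2; rewrite expr1; lra.
  by move=> ->; field; rewrite !gt_eqF.
have E3 : T * n.+1%:R * (1 - m ^+ 2) ^+ 2 = 2 * m.
  have : T * n.+1%:R = 2^-1 * 1 * (-1 * (1 + m)^-1 ^+ 2 + (1 - m)^-1 ^+ 2).
    by move: D3; lra.
  by move=> ->; field; rewrite !gt_eqF.
have nE : n.+1%:R * (1 - m ^+ 2) = 2 * m ^+ 2.
  have -> : n.+1%:R * (1 - m ^+ 2) = n.+1%:R * (1 - m ^+ 2) * (T * m * (1 - m ^+ 2)).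
    by rewrite E2 mulr1.
  have -> : 2 * m ^+ 2 = (T * n.+1%:R * (1 - m ^+ 2) ^+ 2) * m by rewrite E3; ring.
  by ring.
split => //.
rewrite -(pmulr_rlt0 _ m0).
have tE : m * (beta * ((n.+3 * n.+2 * n.+1 * n)%:R * m ^+ n.-1)) = T * n.+1%:R * n%:R.
  rewrite !natrM /T; case: n {D2 D3 pE T E2 E3 nE} => [|n]; first by rewrite !mulr0 !mul0r !mulr0.
  by rewrite /= exprS; ring.
have nE' : n%:R = (3 * m ^+ 2 - 1) / (1 - m ^+ 2).
  by rewrite -natr1 in nE; apply: (mulIf (lt0r_neq0 s0)); rewrite divfK ?gt_eqF//; lra.
have E3' : T * n.+1%:R = 2 * m / (1 - m ^+ 2) ^+ 2.
  by rewrite -E3 mulfK// expf_neq0// gt_eqF.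
rewrite mulrBr tE E3' nE'.
have -> : 2 * m / (1 - m ^+ 2) ^+ 2 * ((3 * m ^+ 2 - 1) / (1 - m ^+ 2)) -
  m * (2^-1 * 2 * ((-1) ^+ 2 * (1 + m)^-1 ^+ 3 + (1 - m)^-1 ^+ 3)) =
  - (4 * m / (1 - m ^+ 2) ^+ 3).
  field; rewrite !gt_eqF//.
by rewrite oppr_lt0 divr_gt0 ?exprn_gt0// mulr_gt0.
Qed.

Lemma Rolle_le (R : realType) (f df : R -> R) (a b : R) : a < b -> f a = f b ->
  (forall x : R, a <= x <= b -> is_derive x 1 f (df x)) ->
  exists2 c, a < c < b & df c = 0.
Proof.
move=> ab fab fd; have [||c] := @MVT R f df a b ab.
- by move=> x; rewrite in_itv/= => /andP[ax xb]; apply: fd; rewrite !ltW.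
- apply: derivable_within_continuous => x; rewrite in_itv/= => /fd.
  by move=> h; exact: (@ex_derive _ _ _ _ _ _ _ h).
- rewrite in_itv/= fab subrr => cab /esym/eqP; rewrite mulf_eq0 subr_eq0.
  by rewrite [b == a]gt_eqF// orbF => /eqP; exists c.
Qed.

Lemma Rolle_between (R : realType) (f df : R -> R) (lo hi a b : R) :
  lo < a < hi -> lo < b < hi -> a != b -> f a = f b ->
  (forall x : R, lo < x < hi -> is_derive x 1 f (df x)) ->
  exists2 c, lo < c < hi /\ c != a & df c = 0.
Proof.
move=> /andP[a1 a2] /andP[b1 b2] + fab fd; rewrite neq_lt => /orP[ab|ba].
- have [x /andP[xa xb]|c /andP[ac cb] dc] := Rolle_le R f df a b ab fab.
    by apply: fd; rewrite (lt_le_trans a1)//= (le_lt_trans xb).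
  by exists c => //; rewrite (lt_trans a1)// (lt_trans cb)// gt_eqF.
- have [x /andP[xa xb]|c /andP[ac cb] dc] := Rolle_le R f df b a ba (esym fab).
    by apply: fd; rewrite (lt_le_trans b1)//= (le_lt_trans xb).
  by exists c => //; rewrite (lt_trans b1)// (lt_trans cb)// lt_eqF.
Qed.

(* If the second derivative vanished at [m], Rolle's theorem would give, from
   two maximizers, two distinct positive stationary points of
   [x ^+ (p - 2) * (1 - x ^+ 2)]. *)
Lemma gmax_nondegenerate (R : realType) (beta h : R) (p : nat) (m y : R) :
  (3 <= p)%N -> 0 < beta -> 0 < h -> is_gmax beta h p m -> is_gmax beta h p y ->
  m != y -> Hder beta h p 2 m < 0.
Proof.
move=> p3 b0 h0 gm gy my.
have m01 := gmax_in_01 R beta h p m p3 b0 h0 gm.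
have y01 := gmax_in_01 R beta h p y p3 b0 h0 gy.
have in1 (x : R) : 0 < x < 1 -> -1 < x < 1.
  by move=> /andP[? ->]; rewrite andbT; lra.
have [m1 m2 m3] := gmax_interior_derivatives R beta h p m (in1 _ m01) gm.
have [y1 _ _] := gmax_interior_derivatives R beta h p y (in1 _ y01) gy.
rewrite lt_neqAle m2 andbT; apply/eqP => D2; have D3 := m3 D2.
move: p3 D2 D3 m1 y1; case: p gm gy m2 m3 => [|[|[|n]]]// _ _ _ _ _ D2 D3 m1 y1.
have [mE _] := degenerate_point R beta h n m m01 D2 D3.
have [c [c01 cm] Dc] := Rolle_between R _ _ _ _ _ _ m01 y01 my (etrans m1 (esym y1))
  (fun x x01 => is_derive_Hder R beta h n.+3 1 x (in1 x x01)).
(* Clearing denominators, a zero of the second derivative satisfies [beta * p * (p - 1) * q x = 1]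
   with [p = n.+3], so [q] agrees at [m] and [c]. *)
pose q (x : R) := x ^+ n.+1 - x ^+ n.+3.
have qE (x : R) : 0 < x < 1 -> Hder beta h n.+3 2 x = 0 ->
    beta * (n.+3 ^_ 2)%:R * q x = 1.
  move=> /andP[x0 x1]; rewrite /Hder subSS subSS subn0 => D.
  have : beta * ((n.+3 ^_ 2)%:R * x ^+ n.+1) =
    2^-1 * 0`!%:R * ((-1) ^+ 0 * (1 + 1 * x)^-1 ^+ 1 + (1 + -1 * x)^-1 ^+ 1).
    by apply/eqP; rewrite -subr_eq0; apply/eqP.
  rewrite fact0 !expr1 expr0 /q => E.
  have -> : x ^+ n.+1 - x ^+ n.+3 = x ^+ n.+1 * (1 - x ^+ 2) by rewrite !exprS; ring.
  have -> : beta * (n.+3 ^_ 2)%:R * (x ^+ n.+1 * (1 - x ^+ 2)) =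
    beta * ((n.+3 ^_ 2)%:R * x ^+ n.+1) * (1 - x ^+ 2) by ring.
  by rewrite E; field; apply/andP; split; lra.
have B0 : beta * (n.+3 ^_ 2)%:R != 0.
  by rewrite mulf_neq0 ?gt_eqF// ltr0n ffact_gt0.
have qcm : q m = q c.
  by apply: (mulfI B0); rewrite !qE.
rewrite eq_sym in cm.
have dq (x : R) : 0 < x < 1 ->
    is_derive x 1 q (n.+1%:R * x ^+ n - n.+3%:R * x ^+ n.+2).
  by move=> _; apply: is_deriveB; exact: is_derive_pow.
have [d [d01 dm] Dd] := Rolle_between R q _ _ _ _ _ m01 c01 cm qcm dq.
move/andP: d01 => [d0 d1]; move/andP: m01 => [m0 m1'].
(* A positive stationary point of [q] has square [n.+1 / n.+3], which by [degenerate_point] is also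
   [m ^+ 2]. *)
have dE : n.+1%:R = n.+3%:R * d ^+ 2.
  have dn : d ^+ n != 0 by rewrite expf_neq0// gt_eqF.
  apply: (mulIf dn); move: Dd; rewrite 2!exprS => Dd.
  by rewrite -[RHS]addr0 -Dd; ring.
have dm2 : d ^+ 2 = m ^+ 2.
  have n3 : n.+3%:R != 0 :> R by rewrite pnatr_eq0.
  apply: (mulfI n3); rewrite -dE.
  have -> : n.+3%:R = n.+1%:R + 2 :> R by rewrite -natrD addn2.
  lra.
move/eqP: dm2; rewrite eqrXn2 ?ltW//; move/negbTE: dm => ->//.
Qed.

(** * The limit distributions *)

(** Dominated convergence with [f] itself as the bound. It is used on half-lines [D n], with [g = f]
    for the limit at [+oo] and [g = 0] for the one at [-oo]. *)
Lemma integral_restrict_cvg (R : realType) (f g : R -> R) (D : nat -> set R) :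
  (forall x, 0 <= f x) ->
  (@lebesgue_measure R).-integrable setT (EFin \o f) ->
  (forall n, measurable (D n)) -> measurable_fun setT g ->
  (forall x, \forall n \near \oo, (f \_ (D n)) x = g x) ->
  fine (\int[lebesgue_measure]_(x in D n) (f x)%:E) @[n --> \oo] -->
    fine (\int[lebesgue_measure]_x (g x)%:E).
Proof.
move=> f0 fi mD mg fg.
have mf : measurable_fun setT f by move/integrableP : fi => -[/measurable_EFinP].
have fle n x : (`|(f \_ (D n)) x| <= f x).
  by rewrite patchE; case: ifP => _; rewrite ?normr0// ger0_norm.
have [|||||gi _ h] := @dominated_convergence _ _ R (@lebesgue_measure R) setT measurableT
  (fun n => EFin \o (f \_ (D n))) (EFin \o g) (EFin \o f).
- move=> n; apply/measurable_EFinP; apply/(measurable_restrictT f (mD n)).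
  exact: measurable_funTS.
- exact/measurable_EFinP.
- apply: aeW => x _; apply: cvg_near_cst; apply: filterS (fg x) => n.
  by rewrite /= => ->.
- exact: fi.
- by apply: aeW => x n _; rewrite /= lee_fin.
have gfin : (\int[lebesgue_measure]_x (g x)%:E)%E \is a fin_num.
  exact: integrable_fin_num gi.
have -> : (fun n => fine (\int[lebesgue_measure]_(x in D n) (f x)%:E)) =
   (fun n => fine (\int[lebesgue_measure]_x ((f \_ (D n)) x)%:E)).
  apply/funext => n; congr fine; rewrite integral_mkcond.
  by apply: eq_integral => x _; rewrite !patchE; case: ifP.
apply: fine_cvg; rewrite fineK//.
Qed.

Lemma density_cdf (R : realType) (f : R -> R) :
  (forall x, 0 <= f x) -> continuous f ->
  (\int[lebesgue_measure]_x (f x)%:E = 1)%E ->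
  let F (x : R) := fine (\int[lebesgue_measure]_(t in `]-oo, x]) (f t)%:E) in
  [/\ forall x : R, is_derive x 1 F (f x), F y @[y --> +oo] --> (1 : R) &
      F y @[y --> -oo] --> (0 : R)].
Proof.
move=> f0 cf f1 F.
have mf : measurable_fun setT f by exact: continuous_measurable_fun.
have fi : (@lebesgue_measure R).-integrable setT (EFin \o f).
  apply/integrableP; split; first exact/measurable_EFinP.
  under eq_integral do rewrite /= ger0_norm//.
  by rewrite f1 ltry.
split.
- move=> x.
  have x1 : x < x + 1 by rewrite ltrDl.
  have fi1 : (@lebesgue_measure R).-integrable `]-oo, x + 1] (EFin \o f).
    exact: integrableS fi.
  have [|dF dFE] := @continuous_FTC1 R f -oo%O x (x + 1) x1 fi1 _ (cf x).
    by rewrite ltNyr.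
  by apply: DeriveDef; [exact: dF|rewrite -derive1E dFE].
- have -> : 1 = fine (\int[lebesgue_measure]_x (f x)%:E)%E :> R by rewrite f1.
  apply/cvg_pinftyP => u uy.
  apply: (@integral_restrict_cvg R f f (fun n => `]-oo, u n]%classic)) => // x.
  have : \forall n \near \oo, x <= u n by move/cvgryPge : uy; exact.
  by apply: filterS => n xu; rewrite patchE mem_set//= in_itv.
- have -> : 0 = fine (\int[lebesgue_measure]_x ((cst 0 : R -> R) x)%:E)%E :> R.
    by rewrite integral0_eq.
  apply/cvg_ninftyP => u uy.
  apply: (@integral_restrict_cvg R f (cst 0) (fun n => `]-oo, u n]%classic)) => // x.
  have : \forall n \near \oo, u n < x by move/cvgrNyPlt : uy; exact.
  apply: filterS => n xu; rewrite patchE memNset//= in_itv/=.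
  by apply/negP; rewrite -ltNge.
Qed.

Lemma Phi_cdf (R : realType) :
  [/\ forall x : R, is_derive x 1 (@Phi R) ((Num.sqrt (2 * pi))^-1 * expR (- (x ^+ 2) / 2)),
      @Phi R y @[y --> +oo] --> (1 : R) & @Phi R y @[y --> -oo] --> (0 : R)].
Proof.
have E : (fun x : R => (Num.sqrt (2 * pi))^-1 * expR (- (x ^+ 2) / 2)) = normal_pdf 0 1.
  apply/funext => x; rewrite normal_pdfE ?oner_eq0//.
  rewrite /normal_peak /normal_fun subr0 expr1n mul1r.
  by congr (_ * expR (_ / _)); rewrite -[pi *+ 2]mulr_natl.
apply: (@density_cdf R (fun x : R => (Num.sqrt (2 * pi))^-1 * expR (- (x ^+ 2) / 2))).
- by move=> x; rewrite mulr_ge0 ?invr_ge0 ?expR_ge0.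
- by rewrite E; apply: continuous_normal_pdf; exact: oner_neq0.
- rewrite -(@integral_normal_pdf R 0 1).
  by apply: eq_integral => x _; rewrite -E.
Qed.

(** * The quartic density and its normalization *)

Lemma continuous_exp_quartic (R : realType) (a : R) :
  continuous (fun t : R => expR (- (a * t ^+ 4))).
Proof.
move=> t; apply: differentiable_continuous; apply/derivable1_diffP.
exact: (@ex_derive _ _ _ _ _ _ _ (is_derive_exp_pow R a 4 t)).
Qed.

Lemma integral_quartic_fin_pos (R : realType) (a : R) : 0 < a ->
  exists2 X : R, 0 < X &
    (\int[lebesgue_measure]_(t in `]0%R, +oo[) (expR (- (a * t ^+ 4)))%:E = X%:E)%E.
Proof.
move=> a0; pose g (t : R) := expR (- (a * t ^+ 4)).
have mg : measurable_fun setT g.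
  by apply: continuous_measurable_fun; exact: continuous_exp_quartic.
have mgE (D : set R) : measurable_fun D (EFin \o g) by exact/measurable_EFinP/measurable_funTS.
have fin : (\int[lebesgue_measure]_(t in `]0%R, +oo[) (g t)%:E < +oo)%E.
  (* Completing the square, [x ^+ 2 - a * x ^+ 4 <= 1 / (4 * a)], which bounds the integrand by a
     multiple of the Gaussian. *)
  apply: (@le_lt_trans _ _ (\int[lebesgue_measure]_t (expR (1 / (4 * a)) * gauss_fun t)%:E)%E).
    apply: (@le_trans _ _ (\int[lebesgue_measure]_t (g t)%:E)%E).
      apply: ge0_subset_integral => //; first exact: mgE.
      by move=> x _; rewrite lee_fin expR_ge0.
    apply: ge0_le_integral => //.
    - by move=> x _; rewrite lee_fin expR_ge0.
    - exact: mgE.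
    - apply/measurable_EFinP; apply: measurable_funM; first exact: measurable_cst.
      exact: measurable_gauss_fun.
    - move=> x _; rewrite lee_fin /g /gauss_fun -expRD ler_expR.
      have h : 0 <= a * (x ^+ 2 - 1 / (2 * a)) ^+ 2 by rewrite mulr_ge0 ?sqr_ge0// ltW.
      have e : a * (x ^+ 2 - 1 / (2 * a)) ^+ 2 = a * x ^+ 4 - x ^+ 2 + 1 / (4 * a).
        by field; rewrite gt_eqF.
      lra.
  under eq_integral do rewrite EFinM.
  rewrite ge0_integralZl_EFin ?expR_ge0//.
  - by rewrite integralT_gauss -EFinM ltry.
  - by move=> x _; rewrite lee_fin gauss_fun_ge0.
  - by apply/measurable_EFinP; exact: measurable_gauss_fun.
have pos : ((expR (- a))%:E <= \int[lebesgue_measure]_(t in `]0%R, +oo[) (g t)%:E)%E.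
  apply: (@le_trans _ _ (\int[lebesgue_measure]_(t in `]0%R, 1%R]) (g t)%:E)%E).
    apply: (@le_trans _ _ (\int[lebesgue_measure]_(t in `]0%R, 1%R]) (cst (expR (- a))%:E) t)%E).
      rewrite integral_cst//= lebesgue_measure_itv/= lte_fin ltr01.
      by rewrite oppr0 adde0 mule1.
    apply: ge0_le_integral => //.
    - by move=> x _; rewrite lee_fin expR_ge0.
    - exact: mgE.
    - move=> x; rewrite /= in_itv/= => /andP[x0 x1]; rewrite lee_fin ler_expR lerN2.
      by rewrite -[leRHS]mulr1 ler_wpM2l ?(ltW a0)// exprn_ile1// ltW.
  apply: ge0_subset_integral => //; first exact: mgE.
  - by move=> x _; rewrite lee_fin expR_ge0.
  - exact: subset_itvl.
case E : (\int[lebesgue_measure]_(t in `]0%R, +oo[) (g t)%:E)%E fin pos => [X| |] //.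
rewrite lee_fin => _ h; exists X => //; apply: lt_le_trans h; exact: expR_gt0.
Qed.

(* The substitution [t = (s / a) ^ (1/4)] has an unbounded derivative at 0, so it
   is performed on [s0, +oo) and [s0] is sent to 0. *)
Lemma quartic_substitution (R : realType) (a s0 : R) : 0 < a -> 0 < s0 ->
  (\int[lebesgue_measure]_(t in `[((s0 / a) `^ (1 / 4))%R, +oo[) (expR (- (a * t ^+ 4)))%R%:E =
   \int[lebesgue_measure]_(s in `[s0, +oo[)
     ((1 / (4 * a `^ (1 / 4)))%R%:E * (s `^ (- (3 / 4)) * expR (- s))%R%:E))%E.
Proof.
move=> a0 s00.
pose r : R := a `^ (1 / 4).
have r0 : 0 < r by exact: powR_gt0.
pose F (s : R) := r^-1 * s `^ (1 / 4).
have FE (s : R) : 0 < s -> F s = (s / a) `^ (1 / 4).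
  move=> sp; rewrite /F powRM ?invr_ge0 ?ltW// mulrC; congr (_ * _).
  by rewrite -(powR_inv1 (ltW a0)) -powRrM mulrC powRrM powR_inv1 ?powR_ge0.
have dF (s : R) : 0 < s -> is_derive s 1 F (r^-1 * (1 / 4 * s `^ (- (3 / 4)))).
  move=> sp; apply: is_derive_scale.
  have := @is_derive1_powR R (1 / 4) s sp.
  by congr (is_derive _ _ _ (_ * _ `^ _)); lra.
have F1 (s : R) : 0 < s -> (derive1 F) s = r^-1 * (1 / 4 * s `^ (- (3 / 4))).
  by move=> sp; rewrite derive1E; have h := dF s sp; exact: derive_val.
have root4 (y : R) : 0 <= y -> (y ^+ 4) `^ (1 / 4) = y.
  move=> y0; rewrite -powR_mulrn// -powRrM.
  have -> : 4%:R * (1 / 4) = 1 :> R by field.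
  by rewrite powRr1.
have root_large (B : R) : 0 <= B -> \forall s \near +oo, 1 <= s /\ B <= s `^ (1 / 4).
  move=> B0; have h : \forall s \near +oo, 1 + B ^+ 4 <= s.
    by apply: nbhs_pinfty_ge; exact: num_real.
  apply: filterS h => s Bs; have B40 : 0 <= B ^+ 4 by exact: exprn_ge0.
  split; first lra.
  by rewrite -[leLHS]root4// ge0_ler_powR ?nnegrE//; lra.
have cpow (s : R) : 0 < s -> {for s, continuous (fun s : R => r^-1 * (1 / 4 * s `^ (- (3 / 4))))}.
  move=> sp; apply: continuousM; first exact: cst_continuous.
  apply: continuousM; first exact: cst_continuous.
  have dp := @is_derive1_powR R (- (3 / 4)) s sp.
  apply: differentiable_continuous; apply/derivable1_diffP.
  exact: (@ex_derive _ _ _ _ _ _ _ dp).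
have F1near (s : R) : 0 < s -> \forall y \near s, r^-1 * (1 / 4 * y `^ (- (3 / 4))) = (derive1 F) y.
  move=> sp; have : \forall y \near s, 0 < y by exact: lt_nbhsr.
  by apply: filterS => y y0; rewrite F1.
have cF1 (s : R) : 0 < s -> {for s, continuous (derive1 F)}.
  move=> sp; rewrite /prop_for /continuous_at F1//.
  by apply: cvg_trans (cpow s sp); apply: near_eq_cvg; exact: F1near.
rewrite -FE// (@increasing_ge0_integration_by_substitutiony R F _ s0); last 8 first.
- move=> x y; rewrite !in_itv/= !andbT => xs ys xy.
  rewrite ltr_pM2l ?invr_gt0//; apply: gt0_ltr_powR => //; rewrite nnegrE.
    by rewrite (le_trans (ltW s00)).
  by rewrite (le_trans (ltW s00)).
- by move=> x; rewrite in_itv/= andbT => xs; apply: cF1; exact: lt_trans xs.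
- apply/cvg_ex; exists ((derive1 F) s0); apply: cvg_at_right_filter; exact: cF1.
- apply/cvg_ex; exists 0; apply/cvgr0Pnorm_le => e e0.
  have b0 : 0 < r^-1 * (1 / 4) / e by rewrite !mulr_gt0 ?invr_gt0.
  apply: filterS (root_large _ (ltW b0)) => s [s1 sb].
  have sp : 0 < s by exact: lt_le_trans s1.
  rewrite F1// mulrA ger0_norm; last by rewrite !mulr_ge0 ?powR_ge0 ?invr_ge0 ?(ltW r0).
  have h1 : s `^ (- (3 / 4)) <= (s `^ (1 / 4))^-1.
    by rewrite -powRN ler_powR//; lra.
  have h2 : 0 < s `^ (1 / 4) by exact: powR_gt0.
  have h3 : 0 < r^-1 * (1 / 4) by rewrite mulr_gt0 ?invr_gt0.
  apply: (le_trans (ler_wpM2l (ltW h3) h1)).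
  by rewrite ler_pdivrMr// [e * _]mulrC -ler_pdivrMr.
- split.
    move=> x; rewrite in_itv/= andbT => xs.
    have h := dF x (lt_trans s00 xs); exact: (@ex_derive _ _ _ _ _ _ _ h).
  apply: cvg_at_right_filter.
  have h := dF s0 s00; apply: differentiable_continuous; apply/derivable1_diffP.
  exact: (@ex_derive _ _ _ _ _ _ _ h).
- apply/cvgryPge => B.
  have rB : 0 <= r * `|B| by rewrite mulr_ge0 ?(ltW r0).
  apply: filterS (root_large _ rB) => s [_ sb].
  by rewrite /F mulrC ler_pdivlMr// mulrC; apply: le_trans sb; rewrite ler_pM2l// ler_norm.
- apply: continuous_subspaceT; exact: continuous_exp_quartic.
- by move=> x _; exact: expR_ge0.
apply: eq_integral => s; rewrite inE/= in_itv/= andbT => ss.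
have sp : 0 < s by exact: lt_le_trans ss.
have p4 (z : R) : 0 < z -> (z `^ (1 / 4)) ^+ 4 = z.
  move=> zp; rewrite -powR_mulrn ?powR_ge0// -powRrM.
  have -> : 1 / 4 * 4%:R = 1 :> R by field.
  by rewrite powRr1// ltW.
rewrite -EFinM; congr (_%:E); rewrite /= fctE F1//= /F exprMn p4// exprVn p4//.
rewrite mulVKf ?gt_eqF// -/r.
by field; rewrite gt_eqF.
Qed.

(** [quartic_substitution] is applied at [s_ n = 1 / (n + 1)], and monotone convergence on both
    sides takes the half-lines to [(0, +oo)]. *)
Lemma Gamma_quarter_integral (R : realType) (a X : R) : 0 < a -> 0 < X ->
  (\int[lebesgue_measure]_(t in `]0%R, +oo[) (expR (- (a * t ^+ 4)))%R%:E = X%:E)%E ->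
  Gamma_quarter R = 4 * a `^ (1 / 4) * X.
Proof.
move=> a0 X0 XE.
have r0 : 0 < a `^ (1 / 4) by exact: powR_gt0.
pose k : R := 1 / (4 * a `^ (1 / 4)).
have k0 : 0 < k by rewrite divr_gt0// mulr_gt0.
pose G (s : R) := s `^ (- (3 / 4)) * expR (- s).
have mG : measurable_fun setT G.
  apply: measurable_funM; first exact: measurable_powR.
  by apply: measurableT_comp => //; exact: measurable_funN.
have mg : measurable_fun setT (fun t : R => expR (- (a * t ^+ 4))).
  by apply: continuous_measurable_fun; exact: continuous_exp_quartic.
pose s_ (n : nat) : R := n.+1%:R^-1.
have s_0 n : 0 < s_ n by rewrite invr_gt0.
pose t_ (n : nat) : R := (s_ n / a) `^ (1 / 4).
have s_le i j : (i <= j)%N -> s_ j <= s_ i.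
  by move=> ij; rewrite lef_pV2 ?posrE// ler_nat.
have t_le i j : (i <= j)%N -> t_ j <= t_ i.
  move=> ij; rewrite ge0_ler_powR ?nnegrE ?divr_ge0 ?(ltW (s_0 _)) ?(ltW a0)//.
  by rewrite ler_pM2r ?invr_gt0//; exact: s_le.
have cvg1 := @ge0_nondecreasing_set_cvg_integral _ (measurableTypeR R) R (fun n => `[s_ n, +oo[%classic)
  (fun s => k%:E * (G s)%:E)%E (@lebesgue_measure R).
have cvg2 := @ge0_nondecreasing_set_cvg_integral _ (measurableTypeR R) R (fun n => `[t_ n, +oo[%classic)
  (fun t => (expR (- (a * t ^+ 4)))%:E) (@lebesgue_measure R).
have u1 : \bigcup_n `[s_ n, +oo[%classic = `]0, +oo[%classic.
  rewrite itvoyEbigcup; apply: eq_bigcup => // n _.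
  by rewrite add0r.
have u2 : \bigcup_n `[t_ n, +oo[%classic = `]0, +oo[%classic.
  apply/seteqP; split => [t [n _]|t]; rewrite /= !in_itv/= !andbT.
    by apply: lt_le_trans; rewrite powR_gt0// divr_gt0.
  move=> t0; have z0 : 0 < a * t ^+ 4 by rewrite mulr_gt0// exprn_gt0.
  exists (Num.truncn (a * t ^+ 4)^-1) => //; rewrite /= in_itv/= andbT /t_.
  have tE : t = (t ^+ 4) `^ (1 / 4).
    rewrite -powR_mulrn ?ltW// -powRrM.
    have -> : 4%:R * (1 / 4) = 1 :> R by field.
    by rewrite powRr1// ltW.
  rewrite [leRHS]tE ge0_ler_powR ?nnegrE ?divr_ge0 ?exprn_ge0 ?(ltW (s_0 _)) ?(ltW a0) ?(ltW t0)//.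
  rewrite ler_pdivrMr//.
  have -> : t ^+ 4 * a = ((a * t ^+ 4)^-1)^-1 by rewrite invrK mulrC.
  rewrite lef_pV2 ?posrE ?invr_gt0//.
  by rewrite ltW// truncnS_gt.
have E n : (\int[lebesgue_measure]_(t in `[t_ n, +oo[) (expR (- (a * t ^+ 4)))%R%:E =
   \int[lebesgue_measure]_(s in `[s_ n, +oo[) (k%:E * (G s)%:E))%E.
  exact: quartic_substitution.
have H : (\int[lebesgue_measure]_(t in `]0%R, +oo[) (expR (- (a * t ^+ 4)))%R%:E =
   \int[lebesgue_measure]_(s in `]0%R, +oo[) (k%:E * (G s)%:E))%E.
  rewrite u1 in cvg1; rewrite u2 in cvg2.
  rewrite -(cvg_lim (@ereal_hausdorff R) (cvg1 _ _ _ _)); first last.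
  - move=> i x _; rewrite -EFinM lee_fin; apply: mulr_ge0; first exact: ltW.
    by rewrite mulr_ge0 ?powR_ge0 ?expR_ge0.
  - move=> i; apply: measurable_funeM; apply/measurable_EFinP; exact: measurable_funTS.
  - by move=> i; exact: measurable_itv.
  - by move=> i j ij; apply/subsetPset; apply: subset_itvr; rewrite bnd_simp s_le.
  rewrite -(cvg_lim (@ereal_hausdorff R) (cvg2 _ _ _ _)); first last.
  - by move=> i x _; rewrite lee_fin expR_ge0.
  - by move=> i; apply/measurable_EFinP; exact: measurable_funTS.
  - by move=> i; exact: measurable_itv.
  - by move=> i j ij; apply/subsetPset; apply: subset_itvr; rewrite bnd_simp t_le.
  by congr (limn _); apply/funext => n; exact: E.
rewrite XE ge0_integralZl_EFin// in H; last 3 first.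
- by move=> x _; rewrite lee_fin mulr_ge0 ?powR_ge0 ?expR_ge0.
- by apply/measurable_EFinP; exact: measurable_funTS.
- exact: ltW.
rewrite /Gamma_quarter -/(G _).
have -> : (\int[lebesgue_measure]_(t in `]0%R, +oo[) (G t)%:E = (k^-1 * X)%:E)%E.
  rewrite EFinM H muleA -EFinM mulVf ?mul1e// gt_eqF//.
by rewrite /= /k; field; rewrite gt_eqF.
Qed.

(** By [Gamma_quarter_integral] the constant of the density is [1 / (2 * X)], with [X] the integral
    over the positive half-line; evenness then gives total mass one. *)
Lemma Fspecial_cdf (R : realType) (c4 : R) : c4 < 0 ->
  exists2 c : R, 0 < c &
  [/\ forall x : R, is_derive x 1 (Fspecial c4) (c * expR (- (- c4 / 24 * x ^+ 4))),
      Fspecial c4 y @[y --> +oo] --> (1 : R) & Fspecial c4 y @[y --> -oo] --> (0 : R)].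
Proof.
move=> c40; pose a := - c4 / 24; have a0 : 0 < a by rewrite divr_gt0// oppr_gt0.
have [X X0 XE] := integral_quartic_fin_pos R a a0.
have GE := Gamma_quarter_integral R a X a0 X0 XE.
have r0 : 0 < a `^ (1 / 4) by exact: powR_gt0.
pose c := 2 / Gamma_quarter R * a `^ (1 / 4).
have c0 : 0 < c by rewrite mulr_gt0// divr_gt0// GE !mulr_gt0.
have cX : c * (2 * X) = 1 by rewrite /c GE; field; rewrite !gt_eqF.
exists c => //.
have E : (fun t : R => c * expR (c4 / 24 * t ^+ 4)) = (fun t : R => c * expR (- (a * t ^+ 4))).
  by apply/funext => t; congr (_ * expR _); rewrite /a; ring.
have cg := continuous_exp_quartic R a.
have mg : measurable_fun setT (fun t : R => expR (- (a * t ^+ 4))).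
  exact: continuous_measurable_fun.
have T : (\int[lebesgue_measure]_x (c * expR (- (a * x ^+ 4)))%R%:E = 1)%E.
  under eq_integral do rewrite EFinM.
  rewrite ge0_integralZl_EFin ?ltW//; last exact/measurable_EFinP.
  rewrite ge0_symfun_integralT//=; last first.
    by move=> x /=; congr (expR (- (_ * _))); ring.
  rewrite -set_itvcy -integral_itv_obnd_cbnd; last first.
    by apply/measurable_EFinP; exact: measurable_funTS.
  by rewrite XE -!EFinM cX.
have f0 (x : R) : 0 <= c * expR (- (a * x ^+ 4)) by rewrite mulr_ge0 ?expR_ge0// ltW.
have cf : continuous (fun x : R => c * expR (- (a * x ^+ 4))).
  move=> x; have : {for x, continuous (fun x : R => c * expR (- (a * x ^+ 4)))}.
    by apply: continuousM; [exact: cst_continuous|exact: cg].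
  exact.
have := density_cdf R _ f0 cf T; cbv zeta.
have -> : (fun x : R => fine (\int[lebesgue_measure]_(t in `]-oo, x]) (c * expR (- (a * t ^+ 4)))%:E))
   = Fspecial c4.
  apply/funext => x; rewrite /Fspecial; congr fine; apply: eq_integral => t _.
  by have := congr1 (@^~ t) E => /= <-.
by [].
Qed.

(** * Fluctuations of the magnetization *)

Lemma eq_cw_cond (R : realType) (beta h : R) (p N : nat) (E E' F F' : pred (config N)) :
  E =1 E' -> F =1 F' -> cw_cond beta h p E F = cw_cond beta h p E' F'.
Proof.
move=> EE FF; rewrite /cw_cond /cw_prob; congr (_ / _); apply: eq_bigl => X //=.
by rewrite EE FF.
Qed.

Lemma cw_cond_all (R : realType) (beta h : R) (p N : nat) (E F : pred (config N)) :
  (forall X, F X) -> cw_cond beta h p E F = cw_prob beta h p E.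
Proof.
move=> FT; rewrite /cw_cond [X in _ / X]cw_prob_all// divr1.
by rewrite /cw_prob; apply: eq_bigl => X /=; rewrite FT andbT.
Qed.

Lemma cvg_scaled_cdf (R : realType) (F : R -> R) (r : R) : 0 < r ->
  F y @[y --> +oo] --> (1 : R) -> F y @[y --> -oo] --> (0 : R) ->
  F (y * r) @[y --> +oo] --> (1 : R) /\ F (y * r) @[y --> -oo] --> (0 : R).
Proof.
move=> r0 F1 F0; split.
- apply: (cvg_comp (fun y : R => y * r) F) F1.
  apply/cvgryPge => A; have h : \forall y \near +oo, A / r <= y.
    by apply: nbhs_pinfty_ge; exact: num_real.
  by apply: filterS h => y; rewrite ler_pdivrMr.
- apply: (cvg_comp (fun y : R => y * r) F) F0.
  apply/cvgrNyPle => A; have h : \forall y \near -oo, y <= A / r.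
    by apply: nbhs_ninfty_le; exact: num_real.
  by apply: filterS h => y; rewrite ler_pdivlMr.
Qed.

(** Here [q = 1] and [e = N ^ (- 1 / 2)]. This scale ignores the variance, so the limit is the
    normal distribution function with its argument multiplied by [sqrt b], [b] being minus the
    second derivative, and [x] is rescaled accordingly at the end. *)
Lemma gaussian_fluctuations (R : realType) (p : nat) (beta h m : R) (A : set R) :
  (3 <= p)%N -> 0 < beta -> 0 < h -> is_gmax beta h p m -> Hder beta h p 2 m < 0 ->
  nbhs m A -> (forall y, is_gmax beta h p y -> closure A y -> y = m) ->
  exists C : R, exists N0 : nat, forall N : nat, (N0 <= N)%N ->
   forall x : R,
     `| cw_cond beta h p
          [pred X : config N |
            (SN X - N%:R * m) / Num.sqrt (- N%:R / derive1n 2 (Hfun beta h p) m) <= x]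
          [pred X : config N | `[< A (SN X / N%:R) >]]
        - Phi x | <= C / Num.sqrt N%:R.
Proof.
move=> p3 b0 h0 gm D2 mA uniq.
have /andP[m0 m1] := gmax_in_01 R beta h p m p3 b0 h0 gm.
have m11 : -1 < m < 1 by rewrite m1 andbT; lra.
have [D1 _ _] := gmax_interior_derivatives R beta h p m m11 gm.
rewrite derive1n_Hfun//.
have [b bp DE] : exists2 b : R, 0 < b & Hder beta h p 2 m = - b.
  by exists (- Hder beta h p 2 m); rewrite ?opprK ?oppr_gt0.
rewrite DE.
have sb : 0 < Num.sqrt b by rewrite sqrtr_gt0.
have s2pi : 0 < Num.sqrt (2 * pi) :> R by rewrite sqrtr_gt0 mulr_gt0// pi_gt0.
have [dPhi Phi1 Phi0] := Phi_cdf R.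
pose F (t : R) := Phi (t * Num.sqrt b).
have [F1 F0] := cvg_scaled_cdf _ _ _ sb Phi1 Phi0.
have a0 : 0 < b / 2 by rewrite divr_gt0.
pose c := (Num.sqrt (2 * pi))^-1 * Num.sqrt b.
have c0 : 0 < c by rewrite mulr_gt0// invr_gt0.
have dF (t : R) : is_derive t 1 F (c * expR (- (b / 2 * t ^+ (2 * 1)))).
  have h1 : is_derive t 1 (fun t : R => t * Num.sqrt b) (Num.sqrt b).
    have := is_derive_affine R 0 (Num.sqrt b) t.
    by congr is_derive; apply/funext => y; rewrite add0r mulrC.
  have hF := @is_derive1_comp R (@Phi R) _ t _ _ (dPhi (t * Num.sqrt b)) h1.
  apply: is_derive_eq_val hF _.
  rewrite /c exprMn sqr_sqrtr ?(ltW bp)// muln1.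
  rewrite [RHS]mulrAC; congr (_ * expR _ * _).
  by field.
have [//|k|del0 [K1 [d0 K10 T]]] := Hfun_taylor R beta h p 2 m m11.
  by case: k => [|[|]].
have taylor (u : R) : `|u| <= del0 ->
    `|Hfun beta h p (m + u) - Hfun beta h p m + b / 2 * u ^+ (2 * 1)|
       <= K1 * `|u| ^+ (2 * 1).+1.
  move=> ud; have [_] := T u ud; rewrite DE muln1 (_ : 2`! = 2)%N//.
  by congr (`|_| <= _); ring.
have [C [N0 main]] := curie_weiss_clt R beta h m _ _ _ _ p 1 A F a0 c0 isT dF F1 F0
  m11 d0 K10 taylor mA (gap_away_from_max R beta h p m A gm uniq).
exists C, N0.+1 => N NN0 x.
have n0 : 0 < N%:R :> R by rewrite ltr0n (leq_ltn_trans _ NN0).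
have sn : 0 < Num.sqrt N%:R :> R by rewrite sqrtr_gt0.
have e0 : 0 < (Num.sqrt N%:R)^-1 :> R by rewrite invr_gt0.
have eN : (Num.sqrt N%:R)^-1 ^+ (2 * 1) = N%:R^-1 :> R.
  by rewrite muln1 exprVn sqr_sqrtr// ltW.
have := main N (ltnW NN0) _ e0 eN (x / Num.sqrt b).
rewrite /F divfK ?gt_eqF//; congr (`|_ - _| <= _).
apply: eq_cw_cond => X //=.
have -> : - N%:R / - b = N%:R / b by rewrite invrN mulrNN.
rewrite sqrtrM ?(ltW n0)// sqrtrV ?(ltW bp)// ler_pdivlMr// invrK.
congr (_ <= _).
have nE : N%:R = Num.sqrt N%:R ^+ 2 :> R by rewrite sqr_sqrtr// ltW.
move: (Num.sqrt N%:R) sn nE => r r0 ->.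
by field; rewrite !gt_eqF.
Qed.

(** Here [q = 2] and [e = N ^ (- 1 / 4)]: the third derivative vanishes by maximality and the fourth
    is negative by [degenerate_point]. The normalization [N ^ (3 / 4)] is [N * e]. *)
Lemma quartic_fluctuations (R : realType) (p : nat) (beta h m : R) :
  (3 <= p)%N -> 0 < beta -> 0 < h -> is_gmax beta h p m -> Hder beta h p 2 m = 0 ->
  (forall y, is_gmax beta h p y -> y = m) ->
  exists C : R, exists N0 : nat, forall N : nat, (N0 <= N)%N ->
   forall x : R,
     `| cw_prob beta h p
          [pred X : config N | (SN X - N%:R * m) / (N%:R `^ (3 / 4)) <= x]
        - Fspecial (derive1n 4 (Hfun beta h p) m) x | <= C / (N%:R `^ (1 / 4)).
Proof.
move=> p3 b0 h0 gm D2 uniq.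
have m01 := gmax_in_01 R beta h p m p3 b0 h0 gm; have /andP[m0 m1] := m01.
have m11 : -1 < m < 1 by rewrite m1 andbT; lra.
have [D1 _ D3] := gmax_interior_derivatives R beta h p m m11 gm.
have {}D3 := D3 D2.
have D4 : Hder beta h p 4 m < 0.
  case: p p3 D2 D3 {gm uniq D1} => [|[|[|n]]]// _ D2 D3.
  by have [] := degenerate_point R beta h n m m01 D2 D3.
rewrite derive1n_Hfun//; set c4 := Hder beta h p 4 m in D4 *.
have [c c0 [dF F1 F0]] := Fspecial_cdf R c4 D4.
have a0 : 0 < - c4 / 24 by rewrite divr_gt0// oppr_gt0.
have [//|k|del0 [K1 [d0 K10 T]]] := Hfun_taylor R beta h p 4 m m11.
  by case: k => [|[|[|[|]]]].
have taylor (u : R) : `|u| <= del0 ->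
    `|Hfun beta h p (m + u) - Hfun beta h p m + - c4 / 24 * u ^+ (2 * 2)|
       <= K1 * `|u| ^+ (2 * 2).+1.
  move=> ud; have [_] := T u ud; rewrite -/c4 (_ : 4`! = 24)%N//.
  by congr (`|_| <= _); rewrite -[(2 * 2)%N]/4%N; ring.
have uniqT (y : R) : is_gmax beta h p y -> closure setT y -> y = m by move=> gy _; exact: uniq.
have [C [N0 main]] := curie_weiss_clt R beta h m _ _ _ _ p 2 setT _ a0 c0 isT dF F1 F0
  m11 d0 K10 taylor filterT (gap_away_from_max R beta h p m setT gm uniqT).
exists C, N0.+1 => N NN0 x.
have n0 : 0 < N%:R :> R by rewrite ltr0n (leq_ltn_trans _ NN0).
have r0 : 0 < N%:R `^ (1 / 4) :> R by exact: powR_gt0.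
have e0 : 0 < (N%:R `^ (1 / 4))^-1 :> R by rewrite invr_gt0.
have eN : (N%:R `^ (1 / 4))^-1 ^+ (2 * 2) = N%:R^-1 :> R.
  rewrite exprVn -powR_mulrn ?powR_ge0// -powRrM.
  have -> : 1 / 4 * (2 * 2)%:R = 1 :> R by rewrite natrM; field.
  by rewrite powRr1// ltW.
have := main N (ltnW NN0) _ e0 eN x; congr (`|_ - _| <= _).
rewrite cw_cond_all; last by move=> X /=; apply/asboolP.
rewrite /cw_prob; apply: eq_bigl => X /=.
congr (_ <= _).
have nE : N%:R = N%:R `^ (3 / 4) * N%:R `^ (1 / 4) :> R.
  rewrite -powRD; last by apply/implyP => _; rewrite gt_eqF.
  have -> : 3 / 4 + 1 / 4 = 1 :> R by field.
  by rewrite powRr1// ltW.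
have q0 : 0 < N%:R `^ (3 / 4) :> R by exact: powR_gt0.
rewrite invrK.
have -> : SN X / N%:R - m = (SN X - N%:R * m) / N%:R :> R by field; rewrite gt_eqF.
rewrite [X in _ / X * _]nE.
by field; rewrite !gt_eqF.
Qed.

Theorem theorem3p2 (R : realType) (p : nat) (beta h : R) :
  (3 <= p)%N -> 0 < beta -> 0 < h ->
  (* 1. p-regular *)
  (p_regular beta h p ->
   forall m : R, is_gmax beta h p m ->
   exists C : R, exists N0 : nat, forall N : nat, (N0 <= N)%N ->
   forall x : R,
     `| cw_prob beta h p
          [pred X : config N |
            (SN X - N%:R * m) / Num.sqrt (- N%:R / derive1n 2 (Hfun beta h p) m) <= x]
        - Phi x | <= C / Num.sqrt N%:R)
  /\
  (* 2. p-critical *)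
  (p_critical beta h p ->
   forall (m : R) (A : set R), is_gmax beta h p m -> nbhs m A ->
   (forall y, is_gmax beta h p y -> closure A y -> y = m) ->
   exists C : R, exists N0 : nat, forall N : nat, (N0 <= N)%N ->
   forall x : R,
     `| cw_cond beta h p
          [pred X : config N |
            (SN X - N%:R * m) / Num.sqrt (- N%:R / derive1n 2 (Hfun beta h p) m) <= x]
          [pred X : config N | `[< A (SN X / N%:R) >]]
        - Phi x | <= C / Num.sqrt N%:R)
  /\
  (* 3. p-special *)
  (p_special beta h p ->
   forall m : R, is_gmax beta h p m ->
   exists C : R, exists N0 : nat, forall N : nat, (N0 <= N)%N ->
   forall x : R, 0 < x ->
     `| cw_prob beta h p
          [pred X : config N | (SN X - N%:R * m) / (N%:R `^ (3 / 4)) <= x]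
        - Fspecial (derive1n 4 (Hfun beta h p) m) x | <= C / (N%:R `^ (1 / 4))).
Proof.
move=> p3 b0 h0; split; last split.
- move=> [m' [m'1 _ uniq D2]] m gm; have mE := uniq m gm.
  have D2' : Hder beta h p 2 m < 0 by rewrite mE -derive1n_Hfun.
  have uniqT (y : R) : is_gmax beta h p y -> closure setT y -> y = m.
    by move=> /uniq -> _; rewrite mE.
  have [C [N0 main]] := gaussian_fluctuations R p beta h m setT p3 b0 h0 gm D2'
    filterT uniqT.
  exists C, N0 => N NN0 x; have := main N NN0 x.
  by rewrite cw_cond_all// => X /=; apply/asboolP.
- move=> [m1 [m2 [m12 g1 g2]]] m A gm mA uniq.
  apply: gaussian_fluctuations => //.
  (* [m] differs from at least one of the two given maximizers, which serves as the second point for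
     [gmax_nondegenerate]. *)
  have [m1m|m1m] := eqVneq m m1.
    by apply: (gmax_nondegenerate R beta h p m m2) => //; rewrite m1m.
  by apply: (gmax_nondegenerate R beta h p m m1).
- move=> [m' [m'1 _ uniq D2]] m gm; have mE := uniq m gm.
  have D2' : Hder beta h p 2 m = 0 by rewrite mE -derive1n_Hfun.
  have uniq' (y : R) : is_gmax beta h p y -> y = m by move=> /uniq ->; rewrite mE.
  have [C [N0 main]] := quartic_fluctuations R p beta h m p3 b0 h0 gm D2' uniq'.
  by exists C, N0 => N NN0 x _; exact: main.
Qed.
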